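(* Let $n\ge 2$, and let $r=\theta^y$, $s=\theta^z$ be as in the context, with $r\ne s$, $\gcd\left(y^{n-1}-y^{n-2}z+\cdots+(-1)^{n-1}z^{n-1},\ell\right)=1$ and $\gcd(y-z,\ell)=1$. Write $\mathfrak u=\mathfrak u_{r,s}(\mathfrak{sl}_n)$ and let $\overline{\mathfrak u}$ be its quotient by central group-like elements. Then the map $$\Phi:\mathcal S_{\overline{\mathfrak u}}\times\mathcal S^1_{\mathfrak u}\to\mathcal S_{\mathfrak u},\qquad \Phi([M],[N])=[M\otimes N],$$ is a bijection if and only if $\gcd((y-z)n,\ell)=1$.
   Context: $\mathbb K$ is an algebraically closed field of characteristic $0$. Let $n\ge2$, let $r,s\in\mathbb K^\times$ be roots of unity with $r\neq s$, let $\ell$ be the least common multiple of the orders of $r$ and $s$, let $\theta$ be a primitive $\ell$th root of unity, and let $y,z$ be nonnegative integers with $r=\theta^y$, $s=\theta^z$. Let $\epsilon_1,\dots,\epsilon_n$ be an orthonormal basis of a Euclidean space with inner product $\langle\,,\rangle$, and $\alpha_j=\epsilon_j-\epsilon_{j+1}$ for $1\le j<n$. $U=U_{r,s}(\mathfrak{sl}_n)$ is the unital associative $\mathbb K$-algebra generated by $e_j,f_j,\omega_j^{\pm1},(\omega_j')^{\pm1}$ ($1\le j<n$) with relations, for all $1\le i,j<n$ (whenever the indices make sense): (R1) the $\omega_i^{\pm1},(\omega_j')^{\pm1}$ all commute and $\omega_i\omega_i^{-1}=\omega_j'(\omega_j')^{-1}=1$; (R2) $\omega_ie_j=r^{\langle\epsilon_i,\alpha_j\rangle}s^{\langle\epsilon_{i+1},\alpha_j\rangle}e_j\omega_i$,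 $\omega_if_j=r^{-\langle\epsilon_i,\alpha_j\rangle}s^{-\langle\epsilon_{i+1},\alpha_j\rangle}f_j\omega_i$; (R3) $\omega_i'e_j=r^{\langle\epsilon_{i+1},\alpha_j\rangle}s^{\langle\epsilon_i,\alpha_j\rangle}e_j\omega_i'$, $\omega_i'f_j=r^{-\langle\epsilon_{i+1},\alpha_j\rangle}s^{-\langle\epsilon_i,\alpha_j\rangle}f_j\omega_i'$; (R4) $[e_i,f_j]=\frac{\delta_{i,j}}{r-s}(\omega_i-\omega_i')$; (R5) $[e_i,e_j]=[f_i,f_j]=0$ if $|i-j|>1$; (R6) $e_i^2e_{i+1}-(r+s)e_ie_{i+1}e_i+rs\,e_{i+1}e_i^2=0$, $e_ie_{i+1}^2-(r+s)e_{i+1}e_ie_{i+1}+rs\,e_{i+1}^2e_i=0$; (R7) $f_i^2f_{i+1}-(r^{-1}+s^{-1})f_if_{i+1}f_i+r^{-1}s^{-1}f_{i+1}f_i^2=0$, $f_if_{i+1}^2-(r^{-1}+s^{-1})f_{i+1}f_if_{i+1}+r^{-1}s^{-1}f_{i+1}^2f_i=0$. It is a Hopf algebra with $\omega_i,\omega_i'$ group-like, $\Delta(e_i)=e_i\otimes1+\omega_i\otimes e_i$, $\Delta(f_i)=1\otimes f_i+f_i\otimes\omega_i'$, $\epsilon(e_i)=\epsilon(f_i)=0$, $S(e_i)=-\omega_i^{-1}e_i$, $S(f_i)=-f_i(\omega_i')^{-1}$. Put $\mathcal E_{j,j}=e_j$, $\mathcal E_{i,j}=e_i\mathcal E_{i-1,j}-r^{-1}\mathcal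 E_{i-1,j}e_i$, $\mathcal F_{j,j}=f_j$, $\mathcal F_{i,j}=f_i\mathcal F_{i-1,j}-s\mathcal F_{i-1,j}f_i$ ($i>j$). The restricted two-parameter quantum group $\mathfrak u_{r,s}(\mathfrak{sl}_n)$ is the (finite-dimensional) Hopf algebra quotient of $U$ by the ideal generated by all $\mathcal E_{i,j}^\ell,\mathcal F_{i,j}^\ell,\omega_i^\ell-1,(\omega_i')^\ell-1$ ($1\le j\le i<n$). For a finite-dimensional Hopf algebra $A$: $G_C(A)$ is the group of central group-like elements of $A$, and $\overline A=A/A(\mathbb KG_C(A))^+$, where $(\mathbb KG_C(A))^+$ is the span of $\{g-1:g\in G_C(A)\}$; $\overline A$ is a Hopf algebra. $\mathcal S_A$ is the set of isomorphism classes of simple $A$-modules and $\mathcal S_A^1\subset\mathcal S_A$ is the subset of classes of one-dimensional modules. $\mathcal S_{\overline A}$ is identified with the subset of $\mathcal S_A$ of classes of simple $A$-modules that factor through $A\to\overline A$. *)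

(* Defs.v *)
From HB Require Import structures.
From mathcomp Require Import all_boot all_order all_algebra.
From mathcomp Require Import finmap.
From mathcomp.multinomials Require Import monalg.
From mathcomp Require Import boolp classical_sets functions.

Set Implicit Arguments.
Unset Strict Implicit.
Unset Printing Implicit Defensive.

Import GRing.Theory.
Local Open Scope ring_scope.
Local Open Scope quotient_scope.

(** * Tensor products *)

(* A formal sum of pure tensors is a list of pairs; two of them are equal in
   V (x) W exactly when no K-bilinear map separates them. *)
Section Tensor.
Variables (K : fieldType) (V W : lmodType K).

Definition bilin (P : lmodType K) (f : V -> W -> P) := bilinear_for *:%R *:%R f.

Definition esum (P : lmodType K) (f : V -> W -> P) (s : seq (V * W)) : P :=
  \sum_(p <- s) f p.1 p.2.

Definition tequiv (s t : seq (V * W)) : bool :=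
  `[< forall (P : lmodType K) (f : V -> W -> P), bilin f -> esum f s = esum f t >].

Lemma tequiv_is_equiv : equiv_class_of tequiv.
Proof.
split=> [s|s t|t s u]; first by apply/asboolP.
- by apply/asboolP/asboolP => h P f fP; rewrite h.
by move=> /asboolP h1 /asboolP h2; apply/asboolP => P f fP; rewrite h1 // h2.
Qed.

Canonical tequiv_equiv := EquivRelPack tequiv_is_equiv.
Canonical tequiv_encModRel := defaultEncModRel tequiv.

Definition tensor : Type := {eq_quot tequiv}.

HB.instance Definition _ := Choice.copy tensor {eq_quot tequiv}.

Definition tclass (s : seq (V * W)) : tensor := \pi_{eq_quot tequiv} s.
Definition trepr (x : tensor) : seq (V * W) := repr (x : {eq_quot tequiv}).

Lemma treprK x : tclass (trepr x) = x.
Proof. exact: (@reprK _ {eq_quot tequiv}). Qed.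

Lemma tclassP s t :
  (forall (P : lmodType K) (f : V -> W -> P), bilin f -> esum f s = esum f t) ->
  tclass s = tclass t.
Proof. by move=> h; apply/eqmodP/asboolP. Qed.

Lemma esum_trepr (P : lmodType K) (f : V -> W -> P) s :
  bilin f -> esum f (trepr (tclass s)) = esum f s.
Proof.
move=> fP; have /eqmodP/asboolP h := treprK (tclass s).
exact: h.
Qed.

Lemma bilin0l (P : lmodType K) (f : V -> W -> P) w : bilin f -> f 0 w = 0.
Proof.
by move=> [h _]; have := h w (-1) 0 0; rewrite /= !scaleN1r oppr0 addr0 addNr.
Qed.

Lemma bilinZl (P : lmodType K) (f : V -> W -> P) k v w :
  bilin f -> f (k *: v) w = k *: f v w.
Proof.
by move=> fP; have := fP.1 w k v 0; rewrite addr0 /= (bilin0l w fP) addr0.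
Qed.

Lemma bilinDl (P : lmodType K) (f : V -> W -> P) v v' w :
  bilin f -> f (v + v') w = f v w + f v' w.
Proof. by move=> fP; have := fP.1 w 1 v v'; rewrite /= !scale1r. Qed.

Lemma bilin0r (P : lmodType K) (f : V -> W -> P) v : bilin f -> f v 0 = 0.
Proof.
by move=> [_ h]; have := h v (-1) 0 0; rewrite /= !scaleN1r oppr0 addr0 addNr.
Qed.

Lemma bilinZr (P : lmodType K) (f : V -> W -> P) k v w :
  bilin f -> f v (k *: w) = k *: f v w.
Proof.
by move=> fP; have := fP.2 v k w 0; rewrite addr0 /= (bilin0r v fP) addr0.
Qed.

Lemma bilinDr (P : lmodType K) (f : V -> W -> P) v w w' :
  bilin f -> f v (w + w') = f v w + f v w'.
Proof. by move=> fP; have := fP.2 v 1 w w'; rewrite /= !scale1r. Qed.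

Definition szscale (k : K) (s : seq (V * W)) := [seq (k *: p.1, p.2) | p <- s].

Lemma esum_scale (P : lmodType K) (f : V -> W -> P) k s :
  bilin f -> esum f (szscale k s) = k *: esum f s.
Proof.
move=> fP; rewrite /esum big_map scaler_sumr.
by apply: eq_bigr => p _; rewrite bilinZl.
Qed.

Lemma esum_cat (P : lmodType K) (f : V -> W -> P) s t :
  esum f (s ++ t) = esum f s + esum f t.
Proof. exact: big_cat. Qed.

Definition tzero : tensor := tclass [::].
Definition tadd (x y : tensor) : tensor := tclass (trepr x ++ trepr y).
Definition tscale (k : K) (x : tensor) : tensor := tclass (szscale k (trepr x)).
Definition topp (x : tensor) : tensor := tscale (-1) x.

Lemma taddE s t : tadd (tclass s) (tclass t) = tclass (s ++ t).
Proof. by apply: tclassP => P f fP; rewrite !esum_cat !esum_trepr. Qed.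

Lemma tscaleE k s : tscale k (tclass s) = tclass (szscale k s).
Proof. by apply: tclassP => P f fP; rewrite !esum_scale // esum_trepr. Qed.

Lemma taddA : associative tadd.
Proof.
move=> x y z; rewrite -[x]treprK -[y]treprK -[z]treprK !taddE.
by rewrite catA.
Qed.

Lemma taddC : commutative tadd.
Proof.
move=> x y; rewrite -[x]treprK -[y]treprK !taddE.
by apply: tclassP => P f fP; rewrite !esum_cat addrC.
Qed.

Lemma tadd0 : left_id tzero tadd.
Proof. by move=> x; rewrite -[x]treprK taddE. Qed.

Lemma taddN : left_inverse tzero topp tadd.
Proof.
move=> x; rewrite -[x]treprK /topp tscaleE taddE.
apply: tclassP => P f fP; rewrite esum_cat esum_scale // scaleN1r addNr.
by rewrite /esum big_nil.
Qed.

HB.instance Definition _ := GRing.isZmodule.Build tensor taddA taddC tadd0 taddN.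

Lemma tscaleA a b v : tscale a (tscale b v) = tscale (a * b) v.
Proof.
rewrite -[v]treprK !tscaleE; apply: tclassP => P f fP.
by rewrite !esum_scale // scalerA.
Qed.

Lemma tscale1 : left_id 1 tscale.
Proof.
move=> x; rewrite -[x]treprK !tscaleE; apply: tclassP => P f fP.
by rewrite !esum_scale // scale1r.
Qed.

Lemma tscaleDr : right_distributive tscale +%R.
Proof.
move=> a x y; rewrite -[x]treprK -[y]treprK.
rewrite -[LHS]/(tscale _ (tadd _ _)) -[RHS]/(tadd _ _).
rewrite taddE !tscaleE taddE; apply: tclassP => P f fP.
by rewrite !(esum_cat, esum_scale) // scalerDr.
Qed.

Lemma tscaleDl v : {morph tscale^~ v : a b / a + b}.
Proof.
move=> a b; rewrite -[v]treprK -[RHS]/(tadd _ _).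
rewrite !tscaleE taddE; apply: tclassP => P f fP.
by rewrite !(esum_cat, esum_scale) // scalerDl.
Qed.

HB.instance Definition _ :=
  GRing.Zmodule_isLmodule.Build K tensor tscaleA tscale1 tscaleDr tscaleDl.

Lemma tclassD s t : tclass s + tclass t = tclass (s ++ t).
Proof. exact: taddE. Qed.

Lemma tclassZ k s : k *: tclass s = tclass (szscale k s).
Proof. exact: tscaleE. Qed.

Definition tens (v : V) (w : W) : tensor := tclass [:: (v, w)].

(* The linear map V (x) W -> P induced by f; meaningful when f is bilinear
   (see tlift_tens and tlift_linear). *)
Definition tlift (P : lmodType K) (f : V -> W -> P) (x : tensor) : P :=
  esum f (trepr x).

Lemma tlift_tens (P : lmodType K) (f : V -> W -> P) v w :
  bilin f -> tlift f (tens v w) = f v w.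
Proof. by move=> fP; rewrite /tlift esum_trepr // /esum big_seq1. Qed.

Lemma tlift_linear (P : lmodType K) (f : V -> W -> P) :
  bilin f -> linear (tlift f).
Proof.
move=> fP k x y; rewrite -[x]treprK -[y]treprK.
rewrite tclassZ tclassD /tlift !esum_trepr //.
by rewrite esum_cat esum_scale.
Qed.

Lemma tens_bilin : bilin tens.
Proof.
split=> [w|v] k x y; rewrite /tens /= tclassZ tclassD;
  apply: tclassP => P f fP; rewrite /esum !big_cons !big_nil /= !addr0.
- by rewrite bilinDl.
- by rewrite bilinDr // bilinZr // bilinZl.
Qed.

Lemma tensor_ind (Q : tensor -> Prop) :
  Q 0 -> (forall v w x, Q x -> Q (tens v w + x)) -> forall x, Q x.
Proof.
move=> Q0 QD x; rewrite -[x]treprK; elim: (trepr x) => [|[v w] s IHs] //.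
have -> : tclass ((v, w) :: s) = tens v w + tclass s by rewrite tclassD.
exact: QD.
Qed.

End Tensor.

Arguments bilin {K V W P} f.
Arguments tens {K V W} v w.
Arguments tlift {K V W P} f x.

Section TensorAlgebra.
Variables (K : fieldType) (A B : algType K).
Local Notation AB := (tensor A B).

Definition tmulf (a : A) (b : B) (c : A) (d : B) : AB := tens (a * c) (b * d).

Definition tmul (x y : AB) : AB :=
  tlift (fun a b => tlift (tmulf a b) y) x.
Definition tone : AB := tens 1 1.

Lemma tmulf_bilin a b : bilin (tmulf a b).
Proof.
by split=> [d|c] k u v; rewrite /tmulf /= mulrDr -scalerAr;
  [exact: (tens_bilin A B).1 | exact: (tens_bilin A B).2].
Qed.

Lemma tlift_bilin (V W V' W' P : lmodType K) (f : V -> W -> V' -> W' -> P) y :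
    (forall v w, bilin (f v w)) ->
    (forall v' w', bilin (fun v w => f v w v' w')) ->
  bilin (fun v w => tlift (f v w) y).
Proof.
move=> h1 h2; split=> [w|v] k u u' /=; rewrite /tlift /esum scaler_sumr -big_split /=;
  apply: eq_bigr => p _.
- exact: (h2 p.1 p.2).1.
- exact: (h2 p.1 p.2).2.
Qed.

Lemma tmulf_bilin' c d : bilin (fun a b => tmulf a b c d).
Proof.
by split=> [b|a] k u v; rewrite /tmulf /= mulrDl -scalerAl;
  [exact: (tens_bilin A B).1 | exact: (tens_bilin A B).2].
Qed.

Let tmul_bilin y := tlift_bilin y tmulf_bilin tmulf_bilin'.

Lemma tmulE a b c d : tmul (tens a b) (tens c d) = tens (a * c) (b * d).
Proof.
rewrite /tmul tlift_tens; last exact: tmul_bilin.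
by rewrite tlift_tens //; apply: tmulf_bilin.
Qed.

Lemma tmul_linl k x x' y : tmul (k *: x + x') y = k *: tmul x y + tmul x' y.
Proof. by apply: tlift_linear; apply: tmul_bilin. Qed.

Lemma tmul_linr k x y y' : tmul x (k *: y + y') = k *: tmul x y + tmul x y'.
Proof.
rewrite /tmul /tlift /esum scaler_sumr -big_split /=; apply: eq_bigr => p _.
exact: (tlift_linear (tmulf_bilin p.1 p.2)).
Qed.

Lemma tmulDl : left_distributive tmul +%R.
Proof. by move=> x y z; have := tmul_linl 1 x y z; rewrite !scale1r. Qed.

Lemma tmulDr : right_distributive tmul +%R.
Proof. by move=> z x y; have := tmul_linr 1 z x y; rewrite !scale1r. Qed.

Lemma tmul0l x : tmul 0 x = 0.
Proof. by have := tmul_linl (-1) 0 0 x; rewrite !scaleN1r oppr0 addr0 addNr. Qed.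

Lemma tmul0r x : tmul x 0 = 0.
Proof. by have := tmul_linr (-1) x 0 0; rewrite !scaleN1r oppr0 addr0 addNr. Qed.

Lemma tmulA : associative tmul.
Proof.
move=> x y z; elim/tensor_ind: x => [|a b x IHx]; first by rewrite !tmul0l.
rewrite !tmulDl -IHx; congr (_ + _).
elim/tensor_ind: y {IHx} => [|c d y IHy]; first by rewrite !(tmul0l, tmul0r).
rewrite !(tmulDl, tmulDr) IHy; congr (_ + _).
elim/tensor_ind: z {IHy} => [|e f z IHz]; first by rewrite !tmul0r.
by rewrite !tmulDr IHz !tmulE !mulrA.
Qed.

Lemma tmul1l : left_id tone tmul.
Proof.
elim/tensor_ind => [|a b x IHx]; first by rewrite tmul0r.
by rewrite tmulDr IHx tmulE !mul1r.
Qed.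

Lemma tmul1r : right_id tone tmul.
Proof.
elim/tensor_ind => [|a b x IHx]; first by rewrite tmul0l.
by rewrite tmulDl IHx tmulE !mulr1.
Qed.

HB.instance Definition _ :=
  GRing.Zmodule_isPzRing.Build AB tmulA tmul1l tmul1r tmulDl tmulDr.

End TensorAlgebra.

(** * Hopf algebras *)

Record hopf (K : fieldType) (A : algType K) := Hopf {
  comul : {lrmorphism A -> tensor A A};
  counit : {lrmorphism A -> K^o};
  antipode : {linear A -> A};
  comulA : forall x,
    tlift (fun a b => tlift (fun a1 a2 => tens a1 (tens a2 b)) (comul a)) (comul x)
    = tlift (fun a b => tens a (comul b)) (comul x) :> tensor A (tensor A A);
  counitl : forall x, tlift (fun a b => counit a *: b) (comul x) = x;
  counitr : forall x, tlift (fun a b => counit b *: a) (comul x) = x;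
  antipodel : forall x,
    tlift (fun a b => antipode a * b) (comul x) = (counit x : K)%:A;
  antipoder : forall x,
    tlift (fun a b => a * antipode b) (comul x) = (counit x : K)%:A
}.

Section CentralGrouplikes.
Variables (K : fieldType) (A : algType K) (H : hopf A).

Definition grouplike (g : A) : Prop := comul H g = tens g g /\ counit H g = 1.

(* G_C(A) *)
Definition central_grouplike (g : A) : Prop :=
  grouplike g /\ forall a, a * g = g * a.

(* A (K G_C(A))^+, the kernel of the projection from A to its quotient by
   central group-like elements. *)
Definition central_ideal (x : A) : Prop :=
  exists2 s : seq (A * A), (forall p, p \in s -> central_grouplike p.2)
                         & x = \sum_(p <- s) p.1 * (p.2 - 1).

End CentralGrouplikes.

(** * Modules *)

(* An A-module seen as a vector space over the base field. *)
Definition restr (K : fieldType) (A : algType K) (M : lmodType A) : Type := M.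

Section Restriction.
Variables (K : fieldType) (A : algType K) (M : lmodType A).

HB.instance Definition _ := GRing.Zmodule.copy (restr M) M.

Definition restr_scale (k : K) (m : restr M) : restr M := k%:A *: (m : M).

Lemma restr_scaleA a b v : restr_scale a (restr_scale b v) = restr_scale (a * b) v.
Proof. by rewrite /restr_scale scalerA -scalerAl mul1r scalerA. Qed.

Lemma restr_scale1 : left_id 1 restr_scale.
Proof. by move=> v; rewrite /restr_scale scale1r scale1r. Qed.

Lemma restr_scaleDr : right_distributive restr_scale +%R.
Proof. by move=> k u v; rewrite /restr_scale scalerDr. Qed.

Lemma restr_scaleDl v : {morph restr_scale^~ v : a b / a + b}.
Proof. by move=> a b; rewrite /restr_scale !scalerDl. Qed.

HB.instance Definition _ := GRing.Zmodule_isLmodule.Build K (restr M)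
  restr_scaleA restr_scale1 restr_scaleDr restr_scaleDl.

End Restriction.

(* M (x) N; H is a parameter because it determines the action of A. *)
Definition tmod (K : fieldType) (A : algType K) (H : hopf A) (M N : lmodType A)
  : Type := tensor (restr M) (restr N).

Section ModuleTensor.
Variables (K : fieldType) (A : algType K) (H : hopf A) (M N : lmodType A).
Local Notation tmod := (tmod H M N).

HB.instance Definition _ := GRing.Zmodule.copy tmod (tensor (restr M) (restr N)).

Definition ptens (m : M) (n : N) : tensor (restr M) (restr N) :=
  tens (m : restr M) (n : restr N).

Definition tactf (a b : A) (m : restr M) (n : restr N) :=
  ptens (a *: (m : M)) (b *: (n : N)).

(* a acts on M (x) N through the coproduct: a (m (x) n) = a_1 m (x) a_2 n. *)
Definition tact (a : A) (x : tmod) : tmod :=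
  tlift (fun a1 a2 => tlift (tactf a1 a2) x) (comul H a).

Lemma restr_scaleC (P : lmodType A) (a : A) (k : K) (m : P) :
  a *: ((k *: (m : restr P)) : P) = k *: ((a *: m) : restr P).
Proof.
by rewrite -[LHS]/(a *: (k%:A *: m)) -[RHS]/(k%:A *: (a *: m)) !scalerA mulr_algr mulr_algl.
Qed.

Lemma restr_scaleZ (P : lmodType A) (a : A) (k : K) (m : P) :
  (k *: a) *: m = k *: ((a *: m) : restr P).
Proof. by rewrite -[RHS]/(k%:A *: (a *: m)) !scalerA mulr_algl. Qed.

Lemma tactf_bilin a b : bilin (tactf a b).
Proof.
split=> [n|m] k u v; rewrite /tactf /ptens.
- rewrite -[_ *: _]/(a *: ((k *: u) + v : M)) scalerDr restr_scaleC.
  exact: (tens_bilin (restr M) (restr N)).1.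
- rewrite -[X in tens _ X]/(b *: ((k *: u) + v : N)) scalerDr restr_scaleC.
  exact: (tens_bilin (restr M) (restr N)).2.
Qed.

Lemma tactf_bilin' m n : bilin (fun a b => tactf a b m n).
Proof.
split=> [b|a] k u v; rewrite /tactf /ptens scalerDl restr_scaleZ.
- exact: (tens_bilin (restr M) (restr N)).1.
- exact: (tens_bilin (restr M) (restr N)).2.
Qed.

Let tact_bilin x : bilin (fun a b => tlift (tactf a b) x) :=
  tlift_bilin x tactf_bilin tactf_bilin'.

Definition ttact (t : tensor A A) (x : tmod) : tmod :=
  tlift (fun a1 a2 => tlift (tactf a1 a2) x) t.

Lemma ttactE a b m n : ttact (tens a b) (ptens m n) = ptens (a *: m) (b *: n).
Proof.
rewrite /ttact tlift_tens; last exact: tact_bilin.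
by rewrite tlift_tens //; apply: tactf_bilin.
Qed.

Lemma ttactDl t t' x : ttact (t + t') x = ttact t x + ttact t' x.
Proof.
by have := tlift_linear (tact_bilin x) 1 t t'; rewrite !scale1r.
Qed.

Lemma ttactDr t x y : ttact t (x + y) = ttact t x + ttact t y.
Proof.
rewrite /ttact /tlift /esum -big_split /=; apply: eq_bigr => p _.
by have := tlift_linear (tactf_bilin p.1 p.2) 1 x y; rewrite !scale1r.
Qed.

Lemma ttact0l x : ttact 0 x = 0.
Proof. by apply: (@addrI _ (ttact 0 x)); rewrite -ttactDl !addr0. Qed.

Lemma ttact0r t : ttact t 0 = 0.
Proof. by apply: (@addrI _ (ttact t 0)); rewrite -ttactDr !addr0. Qed.

Lemma ttactA t t' x : ttact t (ttact t' x) = ttact (t * t') x.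
Proof.
elim/tensor_ind: t => [|a b t IHt]; first by rewrite mul0r !ttact0l.
rewrite mulrDl !ttactDl -IHt; congr (_ + _).
elim/tensor_ind: t' {IHt} => [|c d t' IHt']; first by rewrite mulr0 !ttact0l ttact0r.
rewrite mulrDr !ttactDl ttactDr IHt'; congr (_ + _).
elim/tensor_ind: x {IHt'} => [|m n x IHx]; first by rewrite !ttact0r.
rewrite !ttactDr IHx; congr (_ + _).
by rewrite -[tens a b * _]/(tmul _ _) tmulE !ttactE !scalerA.
Qed.

Lemma ttact1 x : ttact 1 x = x.
Proof.
elim/tensor_ind: x => [|m n x IHx]; first by rewrite ttact0r.
by rewrite ttactDr IHx ttactE !scale1r.
Qed.

Lemma tactA a b v : tact a (tact b v) = tact (a * b) v.
Proof. by rewrite /tact rmorphM -!/(ttact _ _) ttactA. Qed.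

Lemma tact1 : left_id 1 tact.
Proof. by move=> v; rewrite /tact rmorph1; apply: ttact1. Qed.

Lemma tactDr : right_distributive tact +%R.
Proof. by move=> a x y; apply: ttactDr. Qed.

Lemma tactDl v : {morph tact^~ v : a b / a + b}.
Proof. by move=> a b; rewrite /tact rmorphD; apply: ttactDl. Qed.

HB.instance Definition _ := GRing.Zmodule_isLmodule.Build A tmod
  tactA tact1 tactDr tactDl.

End ModuleTensor.

Section ModuleClasses.
Variables (K : fieldType) (A : algType K).
Implicit Types M N L : lmodType A.

Definition isomorphic M N : Prop := exists f : {linear M -> N}, bijective f.

Definition simple M : Prop :=
  (exists m : M, m != 0) /\
  forall S : {pred M}, submod_closed S -> S =i pred1 0 \/ S =i predT.

Definition one_dimensional M : Prop :=
  exists2 m : restr M, m != 0 & forall x, exists k : K, x = k *: m.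

Lemma isomorphic_refl M : isomorphic M M.
Proof. by exists idfun; exists id. Qed.

Lemma isomorphic_sym M N : isomorphic M N -> isomorphic N M.
Proof.
case=> f [g fK gK].
pose gl := GRing.isLinear.Build A N M _ g (can2_linear fK gK).
pose g' : {linear N -> M} := HB.pack g gl.
by exists g'; exists f.
Qed.

Lemma isomorphic_trans M N L : isomorphic M N -> isomorphic N L -> isomorphic M L.
Proof.
case=> f fB [g gB]; exists (g \o f : {linear M -> L}).
exact: bij_comp gB fB.
Qed.

Lemma simple_iso M N : isomorphic M N -> simple M -> simple N.
Proof.
case=> f [g fK gK] [[m m0] sM]; split.
  by exists (f m); apply: contra_neq m0 => fm0; rewrite -[m]fK fm0 -(raddf0 f) fK.
move=> S [S0 Slin].
have [|h|h] := sM (fun m => f m \in S).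
- split=> [|a u v]; first by rewrite /in_mem /= raddf0.
  by rewrite /in_mem /= => Su Sv; rewrite linearP; apply: Slin.
- left=> n; rewrite -[n in LHS]gK -[f (g n) \in S]/(g n \in (fun m => f m \in S)) h.
  by rewrite !inE -(inj_eq (can_inj gK)) -[in RHS](raddf0 f) fK.
- right=> n; rewrite -[n in LHS]gK -[f (g n) \in S]/(g n \in (fun m => f m \in S)) h.
  by rewrite !inE.
Qed.

Variable H : hopf A.
Local Notation "M ** N" := (tmod H M N) (at level 40).

Lemma tact_tens M N a m n :
  a *: (ptens m n : M ** N) = tlift (fun a1 a2 => ptens (a1 *: m) (a2 *: n)) (comul H a).
Proof.
rewrite -[LHS]/(tlift _ _) /tlift /esum; apply: eq_bigr => p _.
by rewrite -[LHS]/(tlift _ (tens _ _)) tlift_tens //; apply: tactf_bilin.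
Qed.

Section Functoriality.
Variables (M M' N N' : lmodType A) (f : {linear M -> M'}) (g : {linear N -> N'}).

Definition tmapf (m : restr M) (n : restr N) : tensor (restr M') (restr N') :=
  ptens (f m) (g n).

Lemma linear_restr (P Q : lmodType A) (h : {linear P -> Q}) :
  linear (h : restr P -> restr Q).
Proof.
by move=> k u v; rewrite -[_ *: u + v]/(k%:A *: (u : P) + (v : P)) linearP.
Qed.

Lemma tmapf_bilin : bilin tmapf.
Proof.
by split=> [n|m] k u v; rewrite /tmapf /ptens;
  [rewrite (linear_restr f); exact: (tens_bilin _ _).1
  |rewrite (linear_restr g); exact: (tens_bilin _ _).2].
Qed.

Definition tmap (x : M ** N) : M' ** N' := tlift tmapf x.

Lemma tmapE m n : tmap (ptens m n) = ptens (f m) (g n).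
Proof. by rewrite /tmap tlift_tens //; apply: tmapf_bilin. Qed.

Lemma tmapD x y : tmap (x + y) = tmap x + tmap y.
Proof. by have := tlift_linear tmapf_bilin 1 x y; rewrite !scale1r. Qed.

Lemma tmap0 : tmap 0 = 0.
Proof. by apply: (@addrI _ (tmap 0)); rewrite -tmapD !addr0. Qed.

Lemma tmap_sum I (s : seq I) (F : I -> M ** N) :
  tmap (\sum_(i <- s) F i) = \sum_(i <- s) tmap (F i).
Proof. exact: (big_morph tmap tmapD tmap0). Qed.

Lemma tmap_linear : linear tmap.
Proof.
move=> a x y; rewrite tmapD; congr (_ + _).
elim/tensor_ind: x => [|m n x IHx]; first by rewrite scaler0 tmap0 scaler0.
rewrite scalerDr !tmapD IHx scalerDr; congr (_ + _).
rewrite -[tens m n]/(ptens (m : M) (n : N)) tmapE !tact_tens /tlift /esum tmap_sum.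
by apply: eq_bigr => p _; rewrite tmapE !linearZ.
Qed.

End Functoriality.

Lemma tmod_iso M M' N N' :
  isomorphic M M' -> isomorphic N N' -> isomorphic (M ** N) (M' ** N').
Proof.
move=> iM iN; have [f [f' fK f'K]] := iM; have [g [g' gK g'K]] := iN.
pose fl := GRing.isLinear.Build A M' M _ f' (can2_linear fK f'K).
pose f1 : {linear M' -> M} := HB.pack f' fl.
pose gl := GRing.isLinear.Build A N' N _ g' (can2_linear gK g'K).
pose g1 : {linear N' -> N} := HB.pack g' gl.
pose hl := GRing.isLinear.Build A (M ** N) (M' ** N') _ (tmap f g) (tmap_linear f g).
pose h : {linear M ** N -> M' ** N'} := HB.pack (tmap f g) hl.
exists h; exists (tmap f1 g1).
- elim/tensor_ind => [|m n x IHx] /=; first by rewrite !tmap0.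
  by rewrite !tmapD [X in _ + X]IHx; congr (_ + _); rewrite !tmapE /= fK gK.
- elim/tensor_ind => [|m n x IHx] /=; first by rewrite !tmap0.
  by rewrite !tmapD [X in _ + X]IHx; congr (_ + _); rewrite !tmapE /= f'K g'K.
Qed.

Lemma tlift_comp (V W P Q : lmodType K) (h : P -> Q) (f : V -> W -> P) x :
  linear h -> h (tlift f x) = tlift (fun v w => h (f v w)) x.
Proof.
move=> hl; pose ll := GRing.isLinear.Build K P Q _ h hl.
pose h' : {linear P -> Q} := HB.pack h ll; exact: (linear_sum h').
Qed.

Section OneDimensional.
Variables (M N : lmodType A) (n0 : N) (c : N -> K).
Hypotheses (n0_neq0 : n0 != 0) (cE : forall x : N, x = c x *: (n0 : restr N)).

Lemma coord_inj k k' : k *: (n0 : restr N) = k' *: (n0 : restr N) -> k = k'.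
Proof.
move/eqP; rewrite -subr_eq0 -scalerBl scaler_eq0 (negPf n0_neq0) orbF subr_eq0.
by move/eqP.
Qed.

Lemma coord_linear : linear (c : restr N -> K^o).
Proof.
move=> k u v; apply: coord_inj.
by rewrite -cE scalerDl -[k *: (c u : K^o)]/(k * c u) -scalerA -!cE.
Qed.

(* the algebra map A -> K through which A acts on the line N *)
Definition chi (a : A) : K := c (a *: n0).

Lemma chiE a : a *: n0 = chi a *: (n0 : restr N).
Proof. exact: cE. Qed.

Lemma chi_linear : linear (chi : A -> K^o).
Proof. by move=> k a b; rewrite /chi scalerDl restr_scaleZ coord_linear. Qed.

Lemma chiM a b : chi (a * b) = chi a * chi b.
Proof.
apply: coord_inj; rewrite -chiE -scalerA chiE [in LHS]restr_scaleC chiE.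
by rewrite scalerA mulrC.
Qed.

Lemma chiP k a b : chi (k *: a + b) = k * chi a + chi b.
Proof. exact: chi_linear. Qed.

Lemma chiA k : chi k%:A = k.
Proof. by apply: coord_inj; rewrite -chiE. Qed.

Definition twist (a : A) : A := tlift (fun a1 a2 => chi a2 *: a1) (comul H a).

Lemma chi_scale_bilin : bilin (fun a1 a2 => chi a2 *: a1 : A).
Proof.
split=> [b|a] k u v /=; first by rewrite scalerDr !scalerA mulrC.
by rewrite chiP scalerDl scalerA.
Qed.

Lemma tact_one_dim a (m : M) : a *: (ptens m n0 : M ** N) = ptens (twist a *: m) n0.
Proof.
rewrite tact_tens -[RHS](tlift_tens (twist a *: m : restr M) (n0 : restr N) (tens_bilin _ _)).
rewrite tlift_tens; last exact: tens_bilin.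
pose h (b : A) : tensor (restr M) (restr N) := ptens (b *: m) n0.
have hl : linear h.
  by move=> k u v; rewrite /h /ptens scalerDl restr_scaleZ (tens_bilin _ _).1.
rewrite -[RHS]/(h (twist a)) /twist tlift_comp //; congr (tlift _ _).
apply/funext => a1; apply/funext => a2.
rewrite /h /ptens restr_scaleZ chiE.
by rewrite bilinZl ?bilinZr //; apply: tens_bilin.
Qed.

Lemma twist_surj a : exists b, twist b = a.
Proof.
pose F3 (a1 a2 b : A) : A := (chi (antipode H b) * chi a2) *: a1.
have F3b a1 : bilin (F3 a1).
  split=> [b|a2] k u v; rewrite /F3 /= ?linearP chiP.
    by rewrite mulrDr scalerDl scalerA mulrCA.
  by rewrite mulrDl scalerDl scalerA -mulrA.
have F3b' a2 b : linear (fun a1 => F3 a1 a2 b).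
  by move=> k u v; rewrite /F3 /= scalerDr !scalerA mulrC.
pose F2 (a1 : A) (y : tensor A A) : A := tlift (F3 a1) y.
have F2b : bilin F2.
  split=> [y|a1]; last exact: tlift_linear.
  move=> k u v; rewrite /F2 /tlift /esum /= scaler_sumr -big_split /=.
  by apply: eq_bigr => p _; rewrite F3b'.
pose F := tlift F2.
have Fl : linear F := tlift_linear F2b.
have twl : linear twist.
  by move=> k u v; rewrite /twist linearP tlift_linear //; apply: chi_scale_bilin.
pose tw : {linear A -> A} := HB.pack twist (GRing.isLinear.Build K A A _ twist twl).
have FE a1 a2 b : F (tens a1 (tens a2 b)) = F3 a1 a2 b.
  by rewrite /F tlift_tens // /F2 tlift_tens.
exists (tlift (fun a1 a2 => chi (antipode H a2) *: a1) (comul H a)).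
transitivity (F (tlift (fun u v =>
    tlift (fun a1 a2 => tens a1 (tens a2 v)) (comul H u)) (comul H a))).
  rewrite !tlift_comp //; congr (tlift _ _); apply/funext => u; apply/funext => v.
  rewrite tlift_comp // -[twist]/(tw : A -> A) linearZ /= /twist.
  rewrite (@tlift_comp _ _ _ _ ( *:%R (chi (antipode H v)))); last exact: linearP.
  by congr (tlift _ _); apply/funext => a1; apply/funext => a2; rewrite FE /F3 scalerA.
rewrite comulA tlift_comp // -[RHS](counitr H a); congr (tlift _ _).
apply/funext => u; apply/funext => v; rewrite /F tlift_tens //.
pose h (b : A) : A := chi b *: u.
have hl : linear h by move=> k b b'; rewrite /h chiP scalerDl scalerA.
transitivity (h (tlift (fun b b' => b * antipode H b') (comul H v))).
  rewrite tlift_comp //; congr (tlift _ _).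
  by apply/funext => b; apply/funext => b'; rewrite /h /F3 chiM mulrC.
by rewrite antipoder /h chiA.
Qed.

Lemma simple_tmod : simple M -> simple (M ** N).
Proof.
case=> [[m0 m0_neq0] sM].
have pD (u v : M) : ptens (u + v) n0 = ptens u n0 + ptens v n0 :> M ** N.
  exact: (bilinDl _ _ _ (tens_bilin (restr M) (restr N))).
have p0 : ptens 0 n0 = 0 :> M ** N.
  exact: (bilin0l _ (tens_bilin (restr M) (restr N))).
have pS (x : M ** N) : exists m : M, x = ptens m n0.
  elim/tensor_ind: x => [|m n x [m' ->]]; first by exists 0.
  exists ((c n *: (m : restr M)) + m'); rewrite pD; congr (_ + _).
  rewrite [in LHS](cE n); have tb := tens_bilin (restr M) (restr N).
  by rewrite /ptens (bilinZl _ _ _ tb) (bilinZr _ _ _ tb).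
pose q : M ** N -> restr M := tlift (fun (m : restr M) (n : restr N) => c n *: m).
have qE m : q (ptens m n0) = m.
  rewrite /q tlift_tens.
    have -> : c n0 = 1 by apply: coord_inj; rewrite -cE scale1r.
    by rewrite scale1r.
  split=> [n|m'] k u v /=; first by rewrite scalerDr !scalerA mulrC.
  by rewrite (coord_linear k u v) scalerDl -[k *: (c u : K^o)]/(k * c u) scalerA.
split.
  exists (ptens m0 n0); apply: contra_neq m0_neq0 => h.
  by rewrite -[m0]qE h -p0 qE.
move=> S [S0 Slin].
have [|h|h] := sM (fun m => (ptens m n0 : M ** N) \in S).
- split=> [|a u v]; first by rewrite /in_mem /= p0.
  rewrite /in_mem /= => Su Sv; have [b <-] := twist_surj a.
  by rewrite pD -tact_one_dim; apply: Slin.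
- left=> x; have [m ->] := pS x.
  rewrite -[_ \in S]/(m \in (fun m => (ptens m n0 : M ** N) \in S)) h !inE.
  apply/eqP/eqP => [->|/(congr1 q)]; first exact: p0.
  by rewrite qE -p0 qE.
- right=> x; have [m ->] := pS x.
  by rewrite -[_ \in S]/(m \in (fun m => (ptens m n0 : M ** N) \in S)) h !inE.
Qed.

End OneDimensional.

Lemma simple_tmod_one_dim M N : simple M -> one_dimensional N -> simple (M ** N).
Proof.
move=> sM [n0 n0_neq0 /choice[c cE]].
exact: (simple_tmod n0_neq0 cE sM).
Qed.

Definition modclass : Type := lmodType A -> Prop.

Definition iso_class M : modclass := fun N => isomorphic M N.

Lemma iso_classP M N : isomorphic M N <-> iso_class M = iso_class N.
Proof.
split=> [MN|e]; last by rewrite -/(iso_class M N) e; apply: isomorphic_refl.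
apply/funext => L; apply/propext; split; apply: isomorphic_trans => //.
exact: isomorphic_sym.
Qed.

(* S_A *)
Definition simple_class : Type :=
  {C : modclass | exists2 M, simple M & C = iso_class M}.

(* S_A^1 *)
Definition one_dim_class : Type :=
  {C : modclass | exists2 M, simple M /\ one_dimensional M & C = iso_class M}.

Definition factors_through_bar M : Prop :=
  forall x, central_ideal H x -> forall m : M, x *: m = 0.

(* The simple modules over the quotient of A by its central group-like
   elements, as a subset of S_A. *)
Definition bar_simple_class : Type :=
  {C : modclass | exists2 M, simple M /\ factors_through_bar M & C = iso_class M}.

(* The class of M (x) N when C and D are the classes of M and N (see
   tensor_classE). *)
Definition tensor_class (C D : modclass) : modclass :=
  fun L => exists M N, [/\ C M, D N & isomorphic (M ** N) L].

Lemma tensor_classE M N :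
  tensor_class (iso_class M) (iso_class N) = iso_class (M ** N).
Proof.
apply/funext => L; apply/propext; split=> [[M' [N' [iM iN iL]]]|iL].
  by apply: isomorphic_trans iL; apply: tmod_iso.
by exists M, N; split=> //; apply: isomorphic_refl.
Qed.

Lemma Phi_subproof (C : bar_simple_class) (D : one_dim_class) :
  exists2 M, simple M & tensor_class (sval C) (sval D) = iso_class M.
Proof.
have [M [sM _] ->] := svalP C; have [N [_ N1] ->] := svalP D.
by exists (M ** N); [apply: simple_tmod_one_dim | apply: tensor_classE].
Qed.

(* ([M], [N]) |-> [M (x) N] *)
Definition Phi (CD : bar_simple_class * one_dim_class) : simple_class :=
  exist _ (tensor_class (sval CD.1) (sval CD.2)) (Phi_subproof CD.1 CD.2).

End ModuleClasses.

(** * Algebras given by generators and relations *)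

Section Ideal.
Variables (K : fieldType) (A : algType K) (P : A -> Prop).

(* the two-sided ideal generated by P *)
Definition ideal : {pred A} := fun x =>
  `[< exists2 s : seq (A * A * A), (forall t, t \in s -> P t.1.2)
        & x = \sum_(t <- s) t.1.1 * t.1.2 * t.2 >].

Lemma ideal_gen x : P x -> x \in ideal.
Proof.
move=> Px; apply/asboolP; exists [:: (1, x, 1)].
  by move=> t; rewrite inE => /eqP ->.
by rewrite big_seq1 /= mul1r mulr1.
Qed.

Lemma idealMlr a b x : x \in ideal -> a * x * b \in ideal.
Proof.
move=> /asboolP[s sP ->]; apply/asboolP.
exists [seq (a * t.1.1, t.1.2, t.2 * b) | t <- s].
  by move=> _ /mapP[t ts ->]; exact: (sP t).
rewrite big_map mulr_sumr mulr_suml; apply: eq_bigr => t _ /=.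
by rewrite !mulrA.
Qed.

Lemma ideal_zmod_closed : zmod_closed ideal.
Proof.
split; first by apply/asboolP; exists [::]; rewrite ?big_nil.
move=> x y /asboolP[s sP ->] yI.
have /asboolP[t tP e] := idealMlr (-1) 1 yI.
apply/asboolP; exists (s ++ t); last by rewrite big_cat /= -e mulN1r mulr1.
by move=> u; rewrite mem_cat => /orP[/sP|/tP].
Qed.

HB.instance Definition _ := GRing.isZmodClosed.Build A ideal ideal_zmod_closed.

Lemma idealMl a x : x \in ideal -> a * x \in ideal.
Proof. by move=> /(idealMlr a 1); rewrite mulr1. Qed.

Lemma idealMr b x : x \in ideal -> x * b \in ideal.
Proof. by move=> /(idealMlr 1 b); rewrite mul1r. Qed.

Lemma ideal_proper (B : nzRingType) (h : {rmorphism A -> B}) :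
  (forall x, P x -> h x = 0) -> 1 \notin ideal.
Proof.
move=> hP; apply/negP => /asboolP[s sP] /(congr1 h).
rewrite rmorph1 raddf_sum big_seq big1 => [/eqP|t ts]; first by rewrite oner_eq0.
by rewrite /= !rmorphM (hP _ (sP _ ts)) mulr0 mul0r.
Qed.

End Ideal.

(* The quotient of A by the two-sided ideal generated by P; algebras are
   required to be nonzero, so the ideal has to be proper. *)
Definition alg_quot (K : fieldType) (A : algType K) (P : A -> Prop)
  (_ : 1 \notin ideal P) : Type := {ideal_quot (ideal P)}.

Section AlgQuotient.
Variables (K : fieldType) (A : algType K) (P : A -> Prop).
Hypothesis P_proper : 1 \notin ideal P.
Local Notation Q := (alg_quot P_proper).
Local Notation I := (ideal P).

HB.instance Definition _ := GRing.Zmodule.copy Q {ideal_quot I}.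

Definition qproj (a : A) : Q := \pi_({ideal_quot I}) a.
Definition qrepr (x : Q) : A := repr (x : {ideal_quot I}).

Lemma qreprK x : qproj (qrepr x) = x.
Proof. exact: reprK. Qed.

Lemma qprojE a b : (qproj a == qproj b) = (a - b \in I).
Proof. by rewrite Quotient.idealrBE. Qed.

Lemma qprojP a b : a - b \in I -> qproj a = qproj b.
Proof. by rewrite -qprojE => /eqP. Qed.

Lemma qrepr_proj a : qrepr (qproj a) - a \in I.
Proof. by rewrite -qprojE qreprK. Qed.

Lemma qprojB : {morph qproj : a b / a - b}.
Proof. exact: (raddfB \pi_({ideal_quot I})). Qed.

Definition qmul (x y : Q) : Q := qproj (qrepr x * qrepr y).
Definition qone : Q := qproj 1.
Definition qscale (k : K) (x : Q) : Q := qproj (k *: qrepr x).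

Lemma qprojD a b : qproj (a + b) = qproj a + qproj b.
Proof. exact: (raddfD \pi_({ideal_quot I})). Qed.

Lemma qmulE a b : qmul (qproj a) (qproj b) = qproj (a * b).
Proof.
apply: qprojP; rewrite -(subrKA (a * qrepr (qproj b))) -mulrBl -mulrBr.
by apply: rpredD; [apply: idealMr | apply: idealMl]; apply: qrepr_proj.
Qed.

Lemma qscaleE k a : qscale k (qproj a) = qproj (k *: a).
Proof.
apply: qprojP; rewrite -scalerBr -mulr_algl.
by rewrite idealMl // qrepr_proj.
Qed.

Lemma qmulA : associative qmul.
Proof. by move=> x y z; rewrite -[x]qreprK -[y]qreprK -[z]qreprK !qmulE mulrA. Qed.

Lemma qmul1l : left_id qone qmul.
Proof. by move=> x; rewrite -[x]qreprK qmulE mul1r. Qed.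

Lemma qmul1r : right_id qone qmul.
Proof. by move=> x; rewrite -[x]qreprK qmulE mulr1. Qed.

Lemma qmulDl : left_distributive qmul +%R.
Proof.
move=> x y z; rewrite -[x]qreprK -[y]qreprK -[z]qreprK.
by rewrite -qprojD !qmulE -qprojD mulrDl.
Qed.

Lemma qmulDr : right_distributive qmul +%R.
Proof.
move=> x y z; rewrite -[x]qreprK -[y]qreprK -[z]qreprK.
by rewrite -qprojD !qmulE -qprojD mulrDr.
Qed.

Lemma qone_neq0 : qone != 0.
Proof. by rewrite -(subrr (qproj 0)) -qprojB qprojE !subr0. Qed.

HB.instance Definition _ :=
  GRing.Zmodule_isNzRing.Build Q qmulA qmul1l qmul1r qmulDl qmulDr qone_neq0.

Lemma qscaleA a b v : qscale a (qscale b v) = qscale (a * b) v.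
Proof. by rewrite -[v]qreprK !qscaleE scalerA. Qed.

Lemma qscale1 : left_id 1 qscale.
Proof. by move=> v; rewrite -[v]qreprK qscaleE scale1r. Qed.

Lemma qscaleDr : right_distributive qscale +%R.
Proof.
by move=> k x y; rewrite -[x]qreprK -[y]qreprK -qprojD !qscaleE -qprojD scalerDr.
Qed.

Lemma qscaleDl v : {morph qscale^~ v : a b / a + b}.
Proof. by move=> a b; rewrite -[v]qreprK !qscaleE -qprojD scalerDl. Qed.

HB.instance Definition _ :=
  GRing.Zmodule_isLmodule.Build K Q qscaleA qscale1 qscaleDr qscaleDl.

Lemma qscaleAl (k : K) (x y : Q) : k *: (x * y) = (k *: x) * y.
Proof.
rewrite -[x]qreprK -[y]qreprK -[LHS]/(qscale k (qmul _ _)).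
rewrite -[RHS]/(qmul (qscale k _) _).
by rewrite qmulE !qscaleE qmulE scalerAl.
Qed.

HB.instance Definition _ := GRing.Lmodule_isLalgebra.Build K Q qscaleAl.

Lemma qscaleAr (k : K) (x y : Q) : k *: (x * y) = x * (k *: y).
Proof.
rewrite -[x]qreprK -[y]qreprK -[LHS]/(qscale k (qmul _ _)).
rewrite -[RHS]/(qmul _ (qscale k _)).
by rewrite qmulE !qscaleE qmulE scalerAr.
Qed.

HB.instance Definition _ := GRing.Lalgebra_isAlgebra.Build K Q qscaleAr.

Lemma qproj_linear : linear qproj.
Proof. by move=> k a b; rewrite qprojD -qscaleE. Qed.

HB.instance Definition _ := GRing.isLinear.Build K A Q _ qproj qproj_linear.

Lemma qproj_monoid : monoid_morphism qproj.
Proof. by split=> // a b; rewrite -qmulE. Qed.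

HB.instance Definition _ := GRing.isMonoidMorphism.Build A Q qproj qproj_monoid.

Lemma qproj_eq0 a : P a -> qproj a = 0.
Proof.
by move=> Pa; rewrite -(raddf0 qproj); apply: qprojP; rewrite subr0 ideal_gen.
Qed.

Section Lift.
Variables (B : algType K) (h : {lrmorphism A -> B}).

Definition qlift (_ : forall a, P a -> h a = 0) (x : Q) : B := h (qrepr x).

Hypothesis hP : forall a, P a -> h a = 0.
Local Notation ql := (qlift hP).

Lemma qlift_proj a : ql (qproj a) = h a.
Proof.
have /asboolP[s sP e] := qrepr_proj a; apply/eqP.
rewrite -subr_eq0 -raddfB e raddf_sum big_seq big1 // => t ts.
by rewrite /= !rmorphM [X in _ * X * _](hP (sP t ts)) mulr0 mul0r.
Qed.

Lemma qlift_linear : linear ql.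
Proof.
by move=> k x y; rewrite -[x]qreprK -[y]qreprK -linearP !qlift_proj linearP.
Qed.

HB.instance Definition _ := GRing.isLinear.Build K Q B _ ql qlift_linear.

Lemma qlift_monoid : monoid_morphism ql.
Proof.
split=> [|x y]; first by rewrite -(rmorph1 qproj) qlift_proj rmorph1.
by rewrite -[x]qreprK -[y]qreprK -rmorphM !qlift_proj rmorphM.
Qed.

HB.instance Definition _ := GRing.isMonoidMorphism.Build Q B ql qlift_monoid.

End Lift.

End AlgQuotient.

(* the free algebra on X, i.e. the algebra of the free monoid on X *)
Definition free_alg (K : fieldType) (X : choiceType) : Type := {malg K[{fmonom X}]}.

(* The product and scaling of {malg _[_]} are sealed, as conversion problems
   that unfold them are intractable. *)
HB.lock Definition free_mul (K : fieldType) (X : choiceType)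
  (x y : {malg K[{fmonom X}]}) : free_alg K X := x * y.

HB.lock Definition free_scale (K : fieldType) (X : choiceType)
  (k : K) (x : {malg K[{fmonom X}]}) : free_alg K X := k *: x.

HB.lock Definition free_gen (K : fieldType) (X : choiceType) (x : X) : free_alg K X :=
  << fmu x >>.

Section FreeAlgebra.
Variables (K : fieldType) (X : choiceType).
Local Notation F := (free_alg K X).
Local Notation M := {malg K[{fmonom X}]}.

HB.instance Definition _ := GRing.Zmodule.copy F M.

Lemma free_scaleA a b v :
  @free_scale K X a (@free_scale K X b v) = free_scale (a * b) v.
Proof. by rewrite free_scale.unlock; apply: (@scalerA _ M). Qed.

Lemma free_scale1 : left_id 1 (@free_scale K X).
Proof. by rewrite free_scale.unlock; apply: (@scale1r _ M). Qed.

Lemma free_scaleDr : right_distributive (@free_scale K X) +%R.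
Proof. by rewrite free_scale.unlock; apply: (@scalerDr _ M). Qed.

Lemma free_scaleDl v : {morph (@free_scale K X)^~ v : a b / a + b}.
Proof. by rewrite free_scale.unlock; apply: (@scalerDl _ M). Qed.

HB.instance Definition _ := GRing.Zmodule_isLmodule.Build K F
  free_scaleA free_scale1 free_scaleDr free_scaleDl.

Lemma free_scaleE (k : K) (x : F) : k *: x = k *: (x : M).
Proof. by rewrite -[LHS]/(free_scale _ _) free_scale.unlock. Qed.

Lemma free_mulA : associative (@free_mul K X).
Proof. by rewrite free_mul.unlock; apply: (@mulrA M). Qed.

Lemma free_mul1l : left_id (1 : M) (@free_mul K X).
Proof. by rewrite free_mul.unlock; apply: (@mul1r M). Qed.

Lemma free_mul1r : right_id (1 : M) (@free_mul K X).
Proof. by rewrite free_mul.unlock; apply: (@mulr1 M). Qed.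

Lemma free_mulDl : left_distributive (@free_mul K X) +%R.
Proof. by rewrite free_mul.unlock; apply: (@mulrDl M). Qed.

Lemma free_mulDr : right_distributive (@free_mul K X) +%R.
Proof. by rewrite free_mul.unlock; apply: (@mulrDr M). Qed.

Lemma free_oner_neq0 : (1 : M) != 0.
Proof. exact: (@oner_neq0 M). Qed.

HB.instance Definition _ := GRing.Zmodule_isNzRing.Build F
  free_mulA free_mul1l free_mul1r free_mulDl free_mulDr free_oner_neq0.

Lemma free_mulE (x y : F) : x * y = (x : M) * (y : M).
Proof. by rewrite -[LHS]/(free_mul _ _) free_mul.unlock. Qed.

Lemma free_scaleAl (k : K) (x y : F) : k *: (x * y) = (k *: x : F) * y.
Proof. by rewrite !free_scaleE !free_mulE; apply: (@scalerAl _ M). Qed.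

HB.instance Definition _ := GRing.Lmodule_isLalgebra.Build K F free_scaleAl.

Lemma free_scaleAr (k : K) (x y : F) : k *: (x * y) = x * (k *: y).
Proof.
rewrite !free_scaleE !free_mulE; apply/malgP => m; rewrite mcoeffZ mcoeffMl.
rewrite (mcoeffMlw m (fsubset_refl _) (msuppZ_le k y)) mulr_sumr.
apply: eq_bigr => u _; rewrite mulr_sumr; apply: eq_bigr => v _.
by rewrite mcoeffZ mulrnAr mulrCA.
Qed.

HB.instance Definition _ := GRing.Lalgebra_isAlgebra.Build K F free_scaleAr.

Section Eval.
Variables (B : algType K) (h : X -> B).

Definition word_eval (m : {fmonom X}) : B := \prod_(x <- (m : seq X)) h x.

Lemma word_eval_morphism : mmorphism word_eval.
Proof.
by split=> [m m'|]; rewrite /word_eval ?fmM ?big_cat // fm1 big_nil.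
Qed.

HB.instance Definition _ :=
  monalg.isMultiplicative.Build {fmonom X} B word_eval word_eval_morphism.

Definition free_eval (a : F) : B := mmap (in_alg B) word_eval a.

Lemma free_eval_linear : linear free_eval.
Proof. by move=> k a b; rewrite free_scaleE /free_eval mmapD mmapZ mulr_algl. Qed.

HB.instance Definition _ := GRing.isLinear.Build K F B _ free_eval free_eval_linear.

Lemma free_eval_monoid : monoid_morphism free_eval.
Proof.
split=> [|x y]; first exact: mmap1.
rewrite free_mulE; apply: (@commr_mmap_is_multiplicative _ _ _ (in_alg B) word_eval _).1.
by move=> g m m'; rewrite /GRing.comm mulr_algl mulr_algr.
Qed.

HB.instance Definition _ := GRing.isMonoidMorphism.Build F B free_eval free_eval_monoid.

Lemma free_evalE x : free_eval (free_gen K x) = h x.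
Proof. by rewrite /free_eval free_gen.unlock mmapU /= scale1r mul1r /word_eval fmU big_seq1. Qed.

End Eval.

End FreeAlgebra.

(** * The two-parameter quantum groups *)

(* The indices 1 <= j < n are represented by 'I_n.-1, i.e. shifted by one. *)
Inductive qg_gen (n : nat) : Type :=
| Ge of 'I_n.-1   (* e_j *)
| Gf of 'I_n.-1   (* f_j *)
| Gw of 'I_n.-1   (* omega_j *)
| GwV of 'I_n.-1  (* omega_j^-1 *)
| Gv of 'I_n.-1   (* omega'_j *)
| GvV of 'I_n.-1. (* omega'_j^-1 *)

HB.instance Definition _ n := gen_eqMixin (qg_gen n).
HB.instance Definition _ n := gen_choiceMixin (qg_gen n).

Definition toral n (x : qg_gen n) : bool :=
  match x with Ge _ | Gf _ => false | _ => true end.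

(* <epsilon_i, alpha_j> = <epsilon_i, epsilon_j - epsilon_(j+1)> *)
Definition pairing (i j : nat) : int := (i == j)%:Z - (i == j.+1)%:Z.

Section QuantumGroups.
Variables (K : fieldType) (n : nat) (r s : K).

Local Notation F := (free_alg K (qg_gen n)).
Local Notation e j := (free_gen K (Ge j)).
Local Notation f j := (free_gen K (Gf j)).
Local Notation w j := (free_gen K (Gw j)).
Local Notation wV j := (free_gen K (GwV j)).
Local Notation v j := (free_gen K (Gv j)).
Local Notation vV j := (free_gen K (GvV j)).

(* An element a - b stands for the relation a = b. *)
Inductive U_relator : F -> Prop :=
| tor_comm x y : toral x -> toral y ->
    U_relator (free_gen K x * free_gen K y - free_gen K y * free_gen K x)
| w_inv i : U_relator (w i * wV i - 1)
| v_inv i : U_relator (v i * vV i - 1)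
| w_e (i j : 'I_n.-1) :
    U_relator (w i * e j - (r ^ pairing i j * s ^ pairing i.+1 j) *: (e j * w i))
| w_f (i j : 'I_n.-1) :
    U_relator (w i * f j - (r ^ (- pairing i j) * s ^ (- pairing i.+1 j)) *: (f j * w i))
| v_e (i j : 'I_n.-1) :
    U_relator (v i * e j - (r ^ pairing i.+1 j * s ^ pairing i j) *: (e j * v i))
| v_f (i j : 'I_n.-1) :
    U_relator (v i * f j - (r ^ (- pairing i.+1 j) * s ^ (- pairing i j)) *: (f j * v i))
| e_f (i j : 'I_n.-1) :
    U_relator (e i * f j - f j * e i - ((i == j)%:R / (r - s)) *: (w i - v i))
| e_far (i j : 'I_n.-1) : (i.+1 < j)%N || (j.+1 < i)%N ->
    U_relator (e i * e j - e j * e i)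
| f_far (i j : 'I_n.-1) : (i.+1 < j)%N || (j.+1 < i)%N ->
    U_relator (f i * f j - f j * f i)
| serre_e1 (i j : 'I_n.-1) : j = i.+1 :> nat ->
    U_relator (e i ^+ 2 * e j - (r + s) *: (e i * e j * e i) + (r * s) *: (e j * e i ^+ 2))
| serre_e2 (i j : 'I_n.-1) : j = i.+1 :> nat ->
    U_relator (e i * e j ^+ 2 - (r + s) *: (e j * e i * e j) + (r * s) *: (e j ^+ 2 * e i))
| serre_f1 (i j : 'I_n.-1) : j = i.+1 :> nat ->
    U_relator (f i ^+ 2 * f j - (r^-1 + s^-1) *: (f i * f j * f i)
               + (r^-1 * s^-1) *: (f j * f i ^+ 2))
| serre_f2 (i j : 'I_n.-1) : j = i.+1 :> nat ->
    U_relator (f i * f j ^+ 2 - (r^-1 + s^-1) *: (f j * f i * f j)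
               + (r^-1 * s^-1) *: (f j ^+ 2 * f i)).

(* the values of the counit on the generators *)
Definition counit_gen (x : qg_gen n) : K^o := (toral x)%:R.

Lemma U_relator_counit a : U_relator a -> free_eval counit_gen a = 0.
Proof.
pose h : F -> K^o := free_eval counit_gen; rewrite -[free_eval _ a]/(h a).
have hB x y : h (x - y) = h x - h y by rewrite /h rmorphB.
have hD x y : h (x + y) = h x + h y by rewrite /h rmorphD.
have hM x y : h (x * y) = h x * h y by rewrite /h rmorphM.
have hZ k x : h (k *: x) = k * h x by rewrite /h linearZ.
have h1 : h 1 = 1 by rewrite /h rmorph1.
have hg x : h (free_gen K x) = (toral x)%:R by rewrite /h free_evalE.
move: h hB hD hM hZ h1 hg => h hB hD hM hZ h1 hg.
case=> {a} [x y xt yt|i|i|i j|i j|i j|i j|i j|i j _|i j _|i j _|i j _|i j _|i j _].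
- by rewrite hB !hM !hg xt yt subrr.
- by rewrite hB hM !hg h1 mulr1 subrr.
- by rewrite hB hM !hg h1 mulr1 subrr.
- by rewrite hB hZ !hM !hg mulr0 mul0r mulr0 subrr.
- by rewrite hB hZ !hM !hg mulr0 mul0r mulr0 subrr.
- by rewrite hB hZ !hM !hg mulr0 mul0r mulr0 subrr.
- by rewrite hB hZ !hM !hg mulr0 mul0r mulr0 subrr.
- by rewrite !hB hZ !hB !hM !hg !mulr0 !subrr mulr0 subrr.
- by rewrite hB !hM !hg mulr0 subrr.
- by rewrite hB !hM !hg mulr0 subrr.
- by rewrite !expr2 hD hB !hZ !hM !hg !mulr0 subrr addr0.
- by rewrite !expr2 hD hB !hZ !hM !hg !mulr0 subrr addr0.
- by rewrite !expr2 hD hB !hZ !hM !hg !mulr0 subrr addr0.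
- by rewrite !expr2 hD hB !hZ !hM !hg !mulr0 subrr addr0.
Qed.

Lemma U_proper : 1 \notin ideal U_relator.
Proof.
apply: (ideal_proper (h := free_eval counit_gen)) => x Ux.
exact: (U_relator_counit Ux).
Qed.

(* U_{r,s}(sl_n) *)
Definition U : algType K := alg_quot U_proper.

Definition Ugen (x : qg_gen n) : U := qproj U_proper (free_gen K x).

(* E_(i,j) for j <= i: rootvec (r^-1) e i j; F_(i,j): rootvec s f i j *)
Fixpoint rootvec (c : K) (x : nat -> U) (i j : nat) : U :=
  if i is i'.+1 then
    if i == j then x j else x i * rootvec c x i' j - c *: (rootvec c x i' j * x i)
  else x j.

Definition ext (x : 'I_n.-1 -> U) (i : nat) : U := oapp x 0 (insub i).

Definition rootE (i j : nat) : U := rootvec r^-1 (ext (Ugen \o @Ge n)) i j.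
Definition rootF (i j : nat) : U := rootvec s (ext (Ugen \o @Gf n)) i j.

Definition U_counit : U -> K^o := 
  @qlift _ _ _ U_proper _ (free_eval counit_gen) U_relator_counit.

HB.instance Definition _ := GRing.LRMorphism.on U_counit.

Lemma U_counit_gen x : U_counit (Ugen x) = (toral x)%:R.
Proof. rewrite /U_counit /Ugen qlift_proj; exact: free_evalE. Qed.

Lemma rootvec_counit c x i j :
  (forall k, U_counit (x k) = 0) -> U_counit (rootvec c x i j) = 0.
Proof.
move=> x0; elim: i => [|i IHi] /=; first exact: x0.
by case: ifP => _ //; rewrite linearB linearZ /= !rmorphM /= x0 mulr0 mul0r scaler0 subrr.
Qed.

Lemma ext_counit (x : 'I_n.-1 -> U) k :
  (forall i, U_counit (x i) = 0) -> U_counit (ext x k) = 0.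
Proof. by rewrite /ext => x0; case: insub => [i|] /=; rewrite ?x0 ?rmorph0. Qed.

Variable l : nat.

Inductive u_relator : U -> Prop :=
| nilE (i j : 'I_n.-1) : (j <= i)%N -> u_relator (rootE i j ^+ l)
| nilF (i j : 'I_n.-1) : (j <= i)%N -> u_relator (rootF i j ^+ l)
| torw (i : 'I_n.-1) : u_relator (Ugen (Gw i) ^+ l - 1)
| torv (i : 'I_n.-1) : u_relator (Ugen (Gv i) ^+ l - 1).

Hypothesis l_gt0 : (0 < l)%N.

Lemma u_relator_counit a : u_relator a -> U_counit a = 0.
Proof.
have l0 : (l == 0)%N = false by rewrite eqn0Ngt l_gt0.
case=> [i j _|i j _|i|i].
- rewrite rmorphXn /= /rootE /rootF rootvec_counit ?expr0n ?l0 // => k.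
  by apply: ext_counit => {}i; rewrite U_counit_gen.
- rewrite rmorphXn /= /rootE /rootF rootvec_counit ?expr0n ?l0 // => k.
  by apply: ext_counit => {}i; rewrite U_counit_gen.
- by rewrite rmorphB rmorph1 rmorphXn /= U_counit_gen expr1n subrr.
- by rewrite rmorphB rmorph1 rmorphXn /= U_counit_gen expr1n subrr.
Qed.

Lemma u_proper : 1 \notin ideal u_relator.
Proof.
apply: (ideal_proper (h := U_counit)) => x ux.
exact: (u_relator_counit ux).
Qed.

(* the restricted quantum group u_{r,s}(sl_n) *)
Definition u : algType K := alg_quot u_proper.

Definition ugen (x : qg_gen n) : u := qproj u_proper (Ugen x).

(* The Hopf structure of U_{r,s}(sl_n), passed to the quotient. A Hopf structure
   on u is determined by these values of its operations on generators. *)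
Definition standard_hopf (H : hopf u) : Prop :=
  [/\ forall i, comul H (ugen (Gw i)) = tens (ugen (Gw i)) (ugen (Gw i)),
      forall i, comul H (ugen (Gv i)) = tens (ugen (Gv i)) (ugen (Gv i)),
      forall i, comul H (ugen (Ge i)) =
        tens (ugen (Ge i)) 1 + tens (ugen (Gw i)) (ugen (Ge i)),
      forall i, comul H (ugen (Gf i)) =
        tens 1 (ugen (Gf i)) + tens (ugen (Gf i)) (ugen (Gv i)) &
      [/\ forall i, counit H (ugen (Ge i)) = 0,
          forall i, counit H (ugen (Gf i)) = 0,
          forall i, antipode H (ugen (Ge i)) = - (ugen (GwV i) * ugen (Ge i)) &
          forall i, antipode H (ugen (Gf i)) = - (ugen (Gf i) * ugen (GvV i))]].

End QuantumGroups.

(* Main.v *)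
Require Import Defs.
From HB Require Import structures.
From mathcomp Require Import all_boot all_order all_algebra.
From mathcomp Require Import ring.
From mathcomp.multinomials Require Import monalg.
From mathcomp Require Import boolp classical_sets.

Set Implicit Arguments.
Unset Strict Implicit.
Unset Printing Implicit Defensive.

Import GRing.Theory.
Local Open Scope ring_scope.

(** Everything is decided by how the characters of the restricted quantum group u
    restrict to the group G of its central group-like elements.

    Write omega^a omega'^b for the toral monomials, with exponent vectors a, b
    over Z/l. As u is generated by toral elements and by the skew-primitive
    elements e_j, f_j, every group-like element is such a monomial
    (grouplike_pointed, grouplike_tor). Moving omega^a omega'^b past e_j
    multiplies it by theta to the j-th entry of aW + bV, where W and V are the
    matrices of weights, and past f_j by the inverse. As e_j is nonzero in u
    (it acts nontrivially on the natural n-dimensional representation), the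
    monomial is central exactly when aW + bV = 0 (central_grouplikeP). A
    one-dimensional module kills e_j and f_j, hence sends omega_j and omega'_j
    to the same l-th root of unity, and these n - 1 roots can be chosen at will.

    For any Hopf algebra, g in G acts on M (x) N, with M trivial on G and N the
    line of a character chi, as the scalar chi(g). So Phi is injective if
    characters are determined by their restrictions to G (Phi_inj), and it is
    surjective if on each simple module G acts through an invertible character
    (Phi_surj). Conversely, if a nontrivial chi is trivial on G, then chi (x) 1
    and 1 (x) chi are two preimages of the class of chi (Phi_inj_triv).

    If n is prime to l, then W - V, which is y - z times the Cartan matrix of
    type A_(n-1), whose determinant is n, is invertible over Z/l, as y - z is a
    unit there. So the
    solutions of aW + bV = 0 are parametrised by a + b; the character with
    exponents x sends omega^a omega'^b to theta^((a + b) . x). Hence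
    restriction identifies characters of u with all characters of G, and
    by Schur's lemma Phi is bijective (Phi_bijective). If a prime p divides n
    and l, take the character with all exponents l/p. The combination of the
    entries of aW + bV with coefficients 1, 2, .., n - 1 is, after
    multiplication by l/p, equal to (l/p)(y + z) times the sum of the entries
    of a + b. The alternating sum of the y^(n-1-i) z^i is n y^(n-1) modulo
    y + z, and it is a unit, so y + z is cancellable modulo p and this nontrivial
    character is trivial on G (Phi_not_injective). *)

(** * Linear functionals *)

Section Functional.
Local Open Scope classical_set_scope.
Variables (K : fieldType) (V : lmodType K).

Definition subspace (W : set V) :=
  W 0 /\ forall k u v, W u -> W v -> W (k *: u + v).

Lemma subspaceZ W k u : subspace W -> W u -> W (k *: u).
Proof. by move=> [W0 WL] Wu; rewrite -[_ *: u]addr0; apply: WL. Qed.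

(** Zorn's lemma. A subspace A maximal among those that contain W and miss x has
    codimension one: together with A, a vector v outside A generates a larger
    subspace, which by maximality contains x. The empty set is
    admitted in the ordered family only to have an upper bound of the empty chain. *)
Lemma maximal_subspace (W : set V) x : subspace W -> ~ W x ->
  exists A, [/\ subspace A, W `<=` A, ~ A x &
    forall v, ~ A v -> exists c, A (v - c *: x)].
Proof.
move=> sW Wx.
pose good A := [/\ subspace A, W `<=` A & ~ A x].
have [|A [[A0|[sA WA Ax]] Amax]] := @Zorn_bigcup V (fun A => A = set0 \/ good A).
- move=> F FP tF; have [[B [FB [sB WB Bx]]]|noB] := pselect (exists B, F B /\ good B); last first.
    left; rewrite -subset0 => y [X FX Xy].
    have [X0|gX] := FP X FX; first by rewrite X0 in Xy.
    by case: noB; exists X.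
  right; split; first split.
  + by exists B => //; case: sB.
  + move=> k a b [X FX Xa] [Y FY Yb].
    have [Z FZ [Za Zb]] : exists2 Z, F Z & Z a /\ Z b.
      by have [XY|YX] := tF X Y FX FY; [exists Y => //; split=> //; apply: XY
                                       |exists X => //; split=> //; apply: YX].
    have [Z0|[[_ ZL] _ _]] := FP Z FZ; first by rewrite Z0 in Za.
    by exists Z => //; apply: ZL.
  + by move=> y /WB By; exists B.
  + move=> [X FX Xx]; have [X0|[_ _]] := FP X FX; last by apply.
    by rewrite X0 in Xx.
- case: (Amax W); last by right; split.
  rewrite A0 properEneq; split; last exact: sub0set.
  by apply/eqP => W0; have [] := sW; rewrite -W0.
- exists A; split=> // v Av.
  have [A0 AL] := sA.
  pose B := [set y | exists k a, A a /\ y = k *: v + a].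
  have AB : A `<=` B by move=> y Ay; exists 0, y; rewrite scale0r add0r.
  have sB : subspace B.
    split; first exact: AB.
    move=> k _ _ [k1 [a1 [Aa1 ->]]] [k2 [a2 [Aa2 ->]]].
    exists (k * k1 + k2), (k *: a1 + a2); split; first exact: AL.
    by rewrite scalerDr scalerA scalerDl addrACA.
  have [k [a [Aa xE]]] : B x.
    apply: contrapT => Bx; case: (Amax B); last by right; split=> // y /WA/AB.
    rewrite properEneq; split=> //; apply/eqP => eAB; apply: Av; rewrite eAB.
    by exists 1, 0; rewrite scale1r addr0.
  have k0 : k != 0.
    by apply/eqP => k0; apply: Ax; rewrite xE k0 scale0r add0r.
  exists k^-1; rewrite xE scalerDr scalerA mulVf // scale1r opprD addrA subrr add0r.
  by rewrite -scaleNr; apply: subspaceZ.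
Qed.

(** Modulo the hyperplane A every v is a multiple of x; phi v is the coefficient. *)
Lemma separating_functional (W : set V) x : subspace W -> ~ W x ->
  exists phi : {linear V -> K^o}, (forall w, W w -> phi w = 0) /\ phi x = 1.
Proof.
move=> sW Wx; have [A [sA WA Ax Amax]] := maximal_subspace sW Wx.
have [A0 AL] := sA.
have /choice[phi phiP] v : exists c, A (v - c *: x).
  have [Av|/Amax//] := pselect (A v); exists 0.
  by rewrite scale0r subr0.
have phiU v c : A (v - c *: x) -> phi v = c.
  move=> Avc; apply/eqP; rewrite -subr_eq0; apply/negP => /negP d0; apply: Ax.
  have := subspaceZ (phi v - c)^-1 sA (AL (-1) _ _ (phiP v) Avc).
  rewrite scaleN1r opprB addrA subrK -scalerBl scalerA.
  by rewrite mulVf // scale1r.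
have phil : linear (phi : V -> K^o).
  move=> k u v; apply: phiU.
  rewrite (_ : _ - _ = k *: (u - phi u *: x) + (v - phi v *: x)).
    exact: AL.
  by rewrite -[k *: (phi u : K^o)]/(k * phi u) scalerBr scalerA addrACA -opprD -scalerDl.
pose phiL : {linear V -> K^o} :=
  HB.pack (phi : V -> K^o) (GRing.isLinear.Build K V K^o _ (phi : V -> K^o) phil).
exists phiL.
split=> [w Ww|] /=; apply: phiU; first by rewrite scale0r subr0; apply: WA.
by rewrite scale1r subrr.
Qed.

End Functional.

(** * Group-like elements of pointed Hopf algebras *)

Section Grouplikes.
Variables (K : fieldType) (A : algType K) (H : hopf A).
Local Notation D := (comul H).

Lemma functional_bilin (phi psi : {linear A -> K^o}) :
  bilin (fun a b => phi a * psi b : K^o).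
Proof.
split=> [b|a] k u v; rewrite linearP /=; first by rewrite mulrDl -scalerAl.
by rewrite mulrDr -scalerAr.
Qed.

Lemma functional_bilinl (phi : {linear A -> K^o}) : bilin (fun a b => phi a *: b : A).
Proof.
split=> [b|a] k u v /=; first by rewrite linearP scalerDl scalerA.
by rewrite scalerDr !scalerA mulrC.
Qed.

Definition span (ts : seq A) (x : A) :=
  exists2 us : seq (K * A), (forall p, p \in us -> p.2 \in ts) & x = \sum_(p <- us) p.1 *: p.2.

Lemma span_subspace ts : subspace (span ts).
Proof.
split; first by exists [::]; rewrite ?big_nil.
move=> k x y [us usT ->] [vs vsT ->].
exists ([seq (k * p.1, p.2) | p <- us] ++ vs).
  by move=> p; rewrite mem_cat => /orP[/mapP[q qus ->]|/vsT//]; apply: (usT q).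
rewrite big_cat big_map /= scaler_sumr; congr (_ + _).
by apply: eq_bigr => p _; rewrite scalerA.
Qed.

Lemma span_mem ts t : t \in ts -> span ts t.
Proof. by exists [:: (1, t)]; rewrite ?big_seq1 ?scale1r // => p; rewrite inE => /eqP->. Qed.

(** Linear independence of group-like elements. If g is not already in the span of
    the tail, take phi that vanishes on the tail with phi g = 1; applying phi to the
    left factor of comul g = g (x) g gives g itself, whereas applying it to the
    coproduct of the linear combination leaves a multiple of t alone. *)
Lemma grouplike_in_span (ts : seq A) (g : A) :
  (forall t, t \in ts -> grouplike H t) -> grouplike H g -> span ts g -> g \in ts.
Proof.
move=> + [gD g1]; elim: ts => [|t ts IH] tsG.
  case=> [[|p us] usT gE]; last by have := usT p (mem_head _ _); rewrite in_nil.
  by move: g1; rewrite gE big_nil raddf0 => /esym/eqP; rewrite oner_eq0.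
have tsG' t' : t' \in ts -> grouplike H t' by move=> ?; apply: tsG; rewrite inE orbC; apply/orP; left.
have [/(IH tsG')|Nspan] := pselect (span ts g); first by rewrite inE orbC => ->.
have [phi [phi0 phig]] := separating_functional (span_subspace ts) Nspan.
move=> [us usT gE].
(* both sides are the image of comul g under phi (x) id *)
have gE2 : g = \sum_(p <- us) (p.1 * phi p.2) *: p.2.
  rewrite -[LHS]scale1r -[X in X *: _]phig.
  have fb := functional_bilinl phi.
  rewrite -(tlift_tens g g fb) -gD [in LHS]gE.
  pose h : {linear tensor A A -> A} := HB.pack (tlift (fun a b => phi a *: b))
    (GRing.isLinear.Build K (tensor A A) A _ _ (tlift_linear fb)).
  rewrite -[LHS]/(h _) !linear_sum big_seq [RHS]big_seq; apply: eq_bigr => p pus.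
  by rewrite !linearZ /= (tsG _ (usT _ pus)).1 tlift_tens // scalerA.
have [k gk] : exists k, g = k *: t.
  rewrite gE2; elim: (us) usT => [|p vs IHv] vsT; first by exists 0; rewrite big_nil scale0r.
  rewrite big_cons; have [|k ->] := IHv; first by move=> q qvs; apply: vsT; rewrite inE qvs orbT.
  have := vsT p (mem_head _ _); rewrite inE => /orP[/eqP->|pts].
    by exists (p.1 * phi t + k); rewrite scalerDl.
  by exists k; rewrite phi0 ?mulr0 ?scale0r ?add0r //; apply: span_mem.
have k1 : k = 1.
  move: g1; rewrite gk linearZ /= (tsG t (mem_head _ _)).2.
  by rewrite -[k *: (1 : K^o)]/(k * 1) mulr1.
by rewrite gk k1 scale1r mem_head.
Qed.

(** T is a monoid of group-like elements and X a set of skew-primitive ones; the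
    filtration of an algebra generated by T and X by the number of factors in X
    is a coalgebra filtration whose degree 0 part is spanned by T. *)
Section Pointed.
Variables (T X : A -> Prop).
Hypothesis T1 : T 1.
Hypothesis TM : forall t u, T t -> T u -> T (t * u).
Hypothesis TG : forall t, T t -> grouplike H t.
Hypothesis XP : forall x, X x ->
  exists g h, [/\ T g, T h & D x = tens x g + tens h x].

Inductive filt : nat -> A -> Prop :=
| filt1 k : filt k 1
| filt_lin k c x y : filt k x -> filt k y -> filt k (c *: x + y)
| filtT k t x : T t -> filt k x -> filt k (t * x)
| filtX k x y : X x -> filt k y -> filt k.+1 (x * y).

Hypothesis AP : forall x, exists k, filt k x.

Lemma filt0 k : filt k 0.
Proof. by have := filt_lin (-1) (filt1 k) (filt1 k); rewrite scaleN1r addNr. Qed.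

Lemma filtW k l x : (k <= l)%N -> filt k x -> filt l x.
Proof.
move=> + fx; elim: fx l => {k x} [k|k c x y _ IHx _ IHy|k t x Tt _ IH|k x y Xx _ IH] l kl.
- exact: filt1.
- by apply: filt_lin; [apply: IHx | apply: IHy].
- by apply: filtT => //; apply: IH.
- by case: l kl => // l kl; apply: filtX => //; apply: IH.
Qed.

(** The tensor filtration: degree k is the sum of the products of degrees i and j
    with i + j at most k. *)
Inductive tfilt (k : nat) : tensor A A -> Prop :=
| tfilt0 : tfilt k 0
| tfilt_add i j a b t :
    (i + j <= k)%N -> filt i a -> filt j b -> tfilt k t -> tfilt k (tens a b + t).

Lemma tfiltD k t u : tfilt k t -> tfilt k u -> tfilt k (t + u).
Proof.
elim=> [|i j a b {}t ijk fa fb _ IH] fu; first by rewrite add0r.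
by rewrite -addrA; apply: tfilt_add ijk fa fb (IH fu).
Qed.

Lemma tfilt_tens k i j a b : (i + j <= k)%N -> filt i a -> filt j b -> tfilt k (tens a b).
Proof. by move=> *; rewrite -[tens a b]addr0; apply: tfilt_add (tfilt0 k); eauto. Qed.

Lemma tfiltZ k c t : tfilt k t -> tfilt k (c *: t).
Proof.
elim=> [|i j a b {}t ijk fa fb _ IH]; first by rewrite scaler0; apply: tfilt0.
rewrite scalerDr -(bilinZl c a b (tens_bilin A A)); apply: tfilt_add ijk _ fb IH.
by rewrite -[_ *: _]addr0; apply: filt_lin => //; apply: filt0.
Qed.

Lemma tensM (a b c d : A) : tens a b * tens c d = tens (a * c) (b * d).
Proof. exact: tmulE. Qed.

Lemma tfiltM_tens k l p q x y t :
    (k + p + q <= l)%N ->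
    (forall i a, filt i a -> filt (i + p) (x * a)) ->
    (forall j b, filt j b -> filt (j + q) (y * b)) ->
  tfilt k t -> tfilt l (tens x y * t).
Proof.
move=> kpq hx hy; elim=> [|i j a b {}t ijk fa fb _ IH].
  by rewrite mulr0; apply: tfilt0.
rewrite mulrDr tensM; apply: tfilt_add (hx _ _ fa) (hy _ _ fb) IH.
by rewrite addnACA -addnA in kpq *; apply: leq_trans kpq; rewrite leq_add2r.
Qed.

Lemma comul_filt k x : filt k x -> tfilt k (D x).
Proof.
have hT t : T t -> forall i a, filt i a -> filt (i + 0) (t * a).
  by move=> Tt i a fa; rewrite addn0; apply: filtT.
have hX x' : X x' -> forall i a, filt i a -> filt (i + 1) (x' * a).
  by move=> Xx i a fa; rewrite addn1; apply: filtX.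
elim=> {k x} [k|k c x y _ IHx _ IHy|k t x Tt _ IH|k x y Xx _ IH].
- by rewrite rmorph1; apply: (@tfilt_tens k 0 0) => //; apply: filt1.
- by rewrite linearP; apply: tfiltD IHy; apply: tfiltZ.
- rewrite rmorphM /= (TG Tt).1.
  by apply: (tfiltM_tens _ (hT t Tt) (hT t Tt) IH); rewrite !addn0.
- rewrite rmorphM /=; have [g [h [Tg Th ->]]] := XP Xx; rewrite mulrDl.
  apply: tfiltD.
    by apply: (tfiltM_tens _ (hX x Xx) (hT g Tg) IH); rewrite addn0 addn1.
  by apply: (tfiltM_tens _ (hT h Th) (hX x Xx) IH); rewrite addn0 addn1.
Qed.

Lemma filt0_span x : filt 0 x -> exists2 ts, (forall t, t \in ts -> T t) & span ts x.
Proof.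
move Ek: 0%N => k fx; elim: fx Ek => {k x} [k|k c x y _ IHx _ IHy|k t x Tt _ IH|//] k0.
- exists [:: 1]; last by apply: span_mem; rewrite mem_head.
  by move=> t; rewrite inE => /eqP->.
- have [ts tsT tsx] := IHx k0; have [us usT usy] := IHy k0.
  exists (ts ++ us); first by move=> t; rewrite mem_cat => /orP[/tsT|/usT].
  apply: (span_subspace _).2.
    by have [vs vsT ->] := tsx; exists vs => // p /vsT; rewrite mem_cat => ->.
  by have [vs vsT ->] := usy; exists vs => // p /vsT; rewrite mem_cat orbC => ->.
- have [ts tsT [us usT ->]] := IH k0; exists [seq t * u | u <- ts].
    by move=> _ /mapP[u uts ->]; apply: TM => //; apply: tsT.
  exists [seq (p.1, t * p.2) | p <- us].
    by move=> _ /mapP[p pus ->]; apply/map_f/usT.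
  by rewrite big_map mulr_sumr; apply: eq_bigr => p _; rewrite scalerAr.
Qed.

(** Let g have degree at most k + 1 but not at most k, and let phi be a functional
    with phi g = 1 that vanishes in degree k. Every term of comul g has a factor of
    degree at most k, as the two degrees add up to at most k + 1; so phi (x) phi
    kills comul g = g (x) g, although its value there is 1. *)
Lemma grouplike_pointed g : grouplike H g -> T g.
Proof.
move=> gG; have [k fg] := AP g; elim: k fg => [|k IH] fg.
  have [ts tsT /grouplike_in_span gts] := filt0_span fg.
  by apply/tsT/gts => // t /tsT/TG.
apply: IH; apply: contrapT => Nfg.
have sF : subspace (filt k) by split; [apply: filt0 | move=> *; apply: filt_lin].
have [phi [phi0 phig]] := separating_functional sF Nfg.
have fb := functional_bilin phi phi.
suff h0 t : tfilt k.+1 t -> tlift (fun a b => phi a * phi b : K^o) t = 0.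
  have := h0 _ (comul_filt fg); rewrite gG.1 tlift_tens // phig => /eqP.
  by rewrite mulr1 oner_eq0.
elim=> [|i j a b {}t ijk fa fb' _ IHt].
  by have := tlift_linear fb (-1) 0 0; rewrite scaler0 addr0 scaleN1r addNr.
rewrite -[tens a b]scale1r (tlift_linear fb) IHt addr0 scale1r tlift_tens //.
case: (ltnP k i) => ik; last by rewrite (phi0 a) ?mul0r //; apply: filtW fa.
rewrite (phi0 b) ?mulr0 //; apply: filtW fb'.
have : (i + j <= i)%N by apply: leq_trans ijk ik.
by rewrite -[X in (_ <= X)%N]addn0 leq_add2l leqn0 => /eqP->.
Qed.

End Pointed.
End Grouplikes.

(** * One-dimensional modules and tensoring with them *)

(** chi is a phantom parameter: it selects the A-module structure put on K below. *)
Definition line (K : fieldType) (A : algType K) (chi : {lrmorphism A -> K^o}) : Type := K.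

Section Line.
Variables (K : fieldType) (A : algType K) (chi : {lrmorphism A -> K^o}).
Local Notation line := (line chi).

HB.instance Definition _ := GRing.Zmodule.copy line K^o.

Definition line_scale (a : A) (x : line) : line := (chi a : K) * (x : K).

Lemma line_scaleA a b x : line_scale a (line_scale b x) = line_scale (a * b) x.
Proof. by rewrite /line_scale rmorphM mulrA. Qed.

Lemma line_scale1 : left_id 1 line_scale.
Proof. by move=> x; rewrite /line_scale rmorph1 mul1r. Qed.

Lemma line_scaleDr : right_distributive line_scale +%R.
Proof. by move=> a x y; rewrite /line_scale -mulrDr. Qed.

Lemma line_scaleDl x : {morph line_scale^~ x : a b / a + b}.
Proof. by move=> a b; rewrite /line_scale raddfD -mulrDl. Qed.

HB.instance Definition _ := GRing.Zmodule_isLmodule.Build A line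
  line_scaleA line_scale1 line_scaleDr line_scaleDl.

Definition line1 : line := (1 : K).

Lemma lineE (a : A) (x : line) : a *: x = (chi a : K) * (x : K) :> K.
Proof. by []. Qed.

Lemma line1_neq0 : line1 != 0.
Proof. exact: (@oner_neq0 K). Qed.

Lemma lineZ1 (x : line) : x = (x : K) *: (line1 : restr line).
Proof.
rewrite -[RHS]/((x : K)%:A *: line1 : line) -[RHS]/(chi (x : K)%:A * 1 : K).
by rewrite linearZ /= rmorph1 mulr1 -[RHS]/((x : K) * 1 : K) mulr1.
Qed.

Lemma line_one_dim : one_dimensional line.
Proof. by exists line1; [exact: line1_neq0 | move=> x; exists (x : K); apply: lineZ1]. Qed.

Lemma line_simple : simple line.
Proof.
split; first by exists line1; apply: line1_neq0.
move=> S [S0 SL].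
have [[x [Sx x0]]|NS] := pselect (exists x : line, x \in S /\ x != 0).
  right=> y; rewrite !inE; have -> : y = ((y : K) / (x : K))%:A *: x + 0.
    rewrite addr0 -[RHS]/(chi ((y : K) / (x : K))%:A * (x : K) : K) linearZ /= rmorph1.
    by rewrite -[_ *: _]/(_ / _ * 1 : K) mulr1 mulfVK.
  exact: SL.
left=> y; rewrite !inE; apply/idP/eqP => [Sy|->//].
by apply/eqP; apply: contrapT => /negP y0; apply: NS; exists y.
Qed.

End Line.

Lemma one_dim_line (K : fieldType) (A : algType K) (N : lmodType A) :
  one_dimensional N -> exists chi : {lrmorphism A -> K^o}, isomorphic N (line chi).
Proof.
move=> [n0 n0N /choice[c cE]].
pose x := chi n0 c.
have xl : linear (x : A -> K^o) := chi_linear n0N cE.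
have xm : monoid_morphism (x : A -> K^o).
  split; first by have := chiA n0N cE 1; rewrite scale1r.
  exact: (chiM n0N cE).
pose X : {lrmorphism A -> K^o} := HB.pack (x : A -> K^o)
  (GRing.isLinear.Build K A K^o _ (x : A -> K^o) xl)
  (GRing.isMonoidMorphism.Build A K^o (x : A -> K^o) xm).
exists X.
pose f : N -> line X := c.
have fl : linear f.
  move=> a u v; apply: (coord_inj n0N); rewrite -cE scalerDl.
  rewrite -[a *: f u]/(x a * c u : K) mulrC -scalerA -(chiE cE) -restr_scaleC.
  by rewrite -!cE.
pose F : {linear N -> line X} := HB.pack f (GRing.isLinear.Build A N (line X) _ f fl).
exists F; exists (fun k => (k : K) *: (n0 : restr N)) => [y|k] /=; first by rewrite /f -cE.
by apply: (coord_inj n0N); rewrite -cE.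
Qed.

Lemma line_iso (K : fieldType) (A : algType K) (chi psi : {lrmorphism A -> K^o}) :
  isomorphic (line chi) (line psi) <-> chi =1 psi.
Proof.
split=> [[f [g fK gK]] a|e].
  have f1 : f (line1 chi) != 0.
    by rewrite -(raddf0 f) (can_eq fK) line1_neq0.
  pose b := a - (chi a : K)%:A.
  have chik (x : {lrmorphism A -> K^o}) k : x k%:A = k.
    by rewrite linearZ /= rmorph1 -[LHS]/(k * 1) mulr1.
  have b0 : b *: line1 chi = 0.
    by rewrite lineE raddfB /= chik subrr mul0r.
  have := linearZ_LR f b (line1 chi); rewrite b0 raddf0 => /esym/eqP.
  rewrite lineE mulf_eq0 (negPf f1) orbF raddfB /= chik subr_eq0 => /eqP.
  by move=> ->.
pose f : line chi -> line psi := fun x => x.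
have fl : linear f by move=> a u v; rewrite /f !lineE e.
exists (HB.pack_for {linear line chi -> line psi} f
  (GRing.isLinear.Build A (line chi) (line psi) _ f fl)).
by exists f.
Qed.

Section Twist.
Variables (K : fieldType) (A : algType K) (H : hopf A).
Implicit Types (M L : lmodType A) (chi psi : {lrmorphism A -> K^o}).

(** a acts on M (x) line chi as its twist acts on M; this is the winding
    automorphism of A attached to chi. *)
Definition char_twist chi (a : A) : A :=
  tlift (fun a1 a2 => (chi a2 : K) *: a1) (comul H a).

Lemma twistE chi : char_twist chi = twist H (line1 chi) (fun x => x : K).
Proof.
apply/funext => a; rewrite /char_twist /twist; congr (tlift _ _).
apply/funext => a1; apply/funext => a2; congr (_ *: _).
by rewrite /Defs.chi lineE [RHS]mulr1.
Qed.

Lemma char_twist_surj chi a : exists b, char_twist chi b = a.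
Proof. by rewrite twistE; apply: (twist_surj H (line1_neq0 chi) (@lineZ1 _ _ chi)). Qed.

Lemma tact_line M chi a (m : M) :
  a *: (ptens m (line1 chi) : tmod H M (line chi)) = ptens (char_twist chi a *: m) (line1 chi).
Proof. by rewrite twistE; apply: (tact_one_dim H (@lineZ1 _ _ chi)). Qed.

Lemma char_twist_bilin chi : bilin (fun a1 a2 => (chi a2 : K) *: a1 : A).
Proof.
split=> [b|a] k u v /=; first by rewrite scalerDr !scalerA mulrC.
by rewrite linearP scalerDl scalerA.
Qed.

Lemma char_twistP chi k a b : char_twist chi (k *: a + b) = k *: char_twist chi a + char_twist chi b.
Proof. by rewrite /char_twist linearP; apply: tlift_linear; apply: char_twist_bilin. Qed.

Lemma char_twistM chi a b : char_twist chi (a * b) = char_twist chi a * char_twist chi b.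
Proof.
rewrite /char_twist rmorphM; have tb := char_twist_bilin chi.
pose t (z : tensor A A) : A := tlift (fun a1 a2 => (chi a2 : K) *: a1) z.
suff tM x y : t (x * y) = t x * t y by apply: tM.
have tD u v : t (u + v) = t u + t v.
  by have := tlift_linear tb 1 u v; rewrite !scale1r.
have t0 : t 0 = 0 by apply: (@addrI _ (t 0)); rewrite -tD !addr0.
elim/tensor_ind: x => [|u v x IH]; first by rewrite !(mul0r, t0).
rewrite mulrDl !tD IH mulrDl; congr (_ + _); elim/tensor_ind: y {IH} => [|w z y IH].
  by rewrite !(mulr0, t0).
rewrite mulrDr !tD IH mulrDr; congr (_ + _).
by rewrite tensM /t !tlift_tens // rmorphM -scalerAl -scalerAr scalerA.
Qed.

Lemma char_twist_grouplike chi g : grouplike H g -> char_twist chi g = (chi g : K) *: g.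
Proof. by move=> [gD _]; rewrite /char_twist gD tlift_tens //; apply: char_twist_bilin. Qed.

Definition unline M chi (x : tmod H M (line chi)) : M :=
  tlift (fun (m : restr M) (k : restr (line chi)) => (k : K) *: m) x.

Lemma unline_bilin M chi :
  bilin (fun (m : restr M) (k : restr (line chi)) => (k : K) *: m).
Proof.
split=> [n|m] k u v /=; first by rewrite scalerDr !scalerA mulrC.
rewrite (_ : k *: u + v = (k * (u : K) + (v : K) : K)); first by rewrite scalerDl scalerA.
congr (_ + _); rewrite -[LHS]/(k%:A *: (u : line chi) : line chi) lineE.
by rewrite linearZ /= rmorph1 -[_ *: _]/(k * 1) mulr1.
Qed.

Lemma ptens_unline M chi (x : tmod H M (line chi)) : ptens (unline x) (line1 chi) = x.
Proof.
have ub := unline_bilin M chi; have tb := tens_bilin (restr M) (restr (line chi)).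
elim/tensor_ind: x => [|m k x IH].
  rewrite /unline (_ : tlift _ _ = 0) ?[LHS](bilin0l _ tb) //.
  by have := tlift_linear ub (-1) 0 0; rewrite scaler0 addr0 scaleN1r addNr.
rewrite -[in RHS]IH [in LHS]/unline -[tens m k]scale1r (tlift_linear ub) !scale1r.
rewrite tlift_tens // [LHS](bilinDl _ _ _ tb); congr (_ + _).
by rewrite [LHS](bilinZl _ _ _ tb) -(bilinZr _ _ _ tb) -lineZ1.
Qed.

Lemma unlineK M chi (m : M) :
  unline (ptens m (line1 chi) : tmod H M (line chi)) = m.
Proof. by rewrite /unline tlift_tens ?scale1r //; apply: unline_bilin. Qed.

Lemma ptens_lineD M chi (m m' : M) :
  ptens (m + m') (line1 chi) =
  (ptens m (line1 chi) : tmod H M (line chi)) + ptens m' (line1 chi).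
Proof. exact: (bilinDl _ _ _ (tens_bilin (restr M) (restr (line chi)))). Qed.

Lemma unlineD M chi (x y : tmod H M (line chi)) : unline (x + y) = unline x + unline y.
Proof.
by rewrite -[x]ptens_unline -[y]ptens_unline -ptens_lineD !unlineK.
Qed.

(** M (x) line chi is M as a vector space, with the action twisted by chi. *)
Lemma tmod_lineP M L chi :
  isomorphic (tmod H M (line chi)) L <->
  exists g : M -> L, [/\ bijective g, {morph g : u v / u + v}
                       & forall a m, g (char_twist chi a *: m) = a *: g m].
Proof.
split=> [[f [f' fK f'K]]|[g [[g' gK g'K] gD gZ]]].
  exists (fun m => f (ptens m (line1 chi))); split.
  - exists (fun y => unline (f' y)) => [m|y]; first by rewrite fK unlineK.
    by rewrite ptens_unline f'K.
  - by move=> u v; rewrite ptens_lineD raddfD.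
  - by move=> a m; rewrite -tact_line linearZ_LR.
pose f (x : tmod H M (line chi)) : L := g (unline x).
have fl : linear f.
  move=> a x y; rewrite /f unlineD gD; congr (_ + _).
  by rewrite -gZ -[in LHS](ptens_unline x) tact_line unlineK.
exists (HB.pack_for {linear tmod H M (line chi) -> L} f
  (GRing.isLinear.Build A (tmod H M (line chi)) L _ f fl)).
exists (fun y => ptens (g' y) (line1 chi)) => [x|y] /=.
  by rewrite /f gK ptens_unline.
by rewrite /f unlineK g'K.
Qed.

(** Twisting is surjective on A, so a map that intertwines twisted actions
    intertwines the original ones. *)
Lemma tmod_line_inj M M' chi :
  isomorphic (tmod H M (line chi)) (tmod H M' (line chi)) -> isomorphic M M'.
Proof.
move=> /tmod_lineP[g [[g' gK g'K] gD gZ]].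
pose f m := unline (g m).
have fl : linear f.
  move=> a u v; rewrite /f gD unlineD; congr (_ + _).
  have [b <-] := char_twist_surj chi a.
  by rewrite gZ -[g u]ptens_unline tact_line !unlineK.
exists (HB.pack_for {linear M -> M'} f (GRing.isLinear.Build A M M' _ f fl)).
exists (fun m => g' (ptens m (line1 chi))) => [m|m] /=.
  by rewrite /f ptens_unline gK.
by rewrite /f g'K unlineK.
Qed.

Lemma tmod_line_inv M chi psi : (forall a, char_twist psi (char_twist chi a) = a) ->
  isomorphic (tmod H (tmod H M (line psi)) (line chi)) M.
Proof.
move=> inv; apply/tmod_lineP; exists (@unline M psi); split.
- by exists (fun m => ptens m (line1 psi)) => [x|m]; rewrite ?ptens_unline ?unlineK.
- exact: unlineD.
- by move=> a x; rewrite -[x in LHS]ptens_unline tact_line unlineK inv.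
Qed.

Lemma grouplike_line M chi g (m : M) : grouplike H g ->
  g *: (ptens m (line1 chi) : tmod H M (line chi)) =
  ptens ((chi g : K) *: ((g *: m) : restr M)) (line1 chi).
Proof. by move=> gG; rewrite tact_line char_twist_grouplike // restr_scaleZ. Qed.

Definition triv_char : {lrmorphism A -> K^o} := counit H.

Lemma line_bar chi : (forall g, central_grouplike H g -> chi g = 1) ->
  factors_through_bar H (line chi).
Proof.
move=> h x [s sG ->] m; rewrite scaler_suml big_seq big1 // => p ps.
by rewrite lineE rmorphM raddfB /= rmorph1 (h _ (sG p ps)) subrr mulr0 mul0r.
Qed.

Lemma bar_grouplike M g : factors_through_bar H M -> central_grouplike H g ->
  forall m : M, g *: m = m.
Proof.
move=> bM gC m; have /bM/(_ m) : central_ideal H (g - 1).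
  by exists [:: (1, g)]; rewrite ?big_seq1 ?mul1r // => p; rewrite inE => /eqP->.
by rewrite scalerBl scale1r => /eqP; rewrite subr_eq0 => /eqP.
Qed.

Lemma tmod_triv M : isomorphic (tmod H M (line triv_char)) M.
Proof.
apply/tmod_lineP; exists id; split=> [|//|a m]; first by exists id.
by rewrite /char_twist counitr.
Qed.

Lemma triv_tmod chi : isomorphic (tmod H (line triv_char) (line chi)) (line chi).
Proof.
apply/tmod_lineP; exists id; split=> [|//|a m]; first by exists id.
rewrite !lineE; congr (_ * _); rewrite -[in RHS](counitl H a) /char_twist.
rewrite !linear_sum; apply: eq_bigr => p _; rewrite !linearZ /=.
by rewrite -![_ *: _]/(_ * _ : K) mulrC.
Qed.

End Twist.

(** * Bijectivity of the tensor product map in terms of characters *)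

Section Classes.
Variables (K : fieldType) (A : algType K) (H : hopf A).
Implicit Types (M L : lmodType A) (chi psi : {lrmorphism A -> K^o}).

Lemma line_class_subproof chi :
  exists2 M : lmodType A, simple M /\ one_dimensional M & iso_class (line chi) = iso_class M.
Proof. by exists (line chi); split; [apply: line_simple | apply: line_one_dim]. Qed.

Definition line_class chi : one_dim_class A := exist _ _ (line_class_subproof chi).

Lemma bar_line_class_subproof chi : (forall g, central_grouplike H g -> chi g = 1) ->
  exists2 M : lmodType A,
    simple M /\ factors_through_bar H M & iso_class (line chi) = iso_class M.
Proof. by exists (line chi) => //; split; [apply: line_simple | apply: line_bar]. Qed.

Definition bar_line_class chi (h : forall g, central_grouplike H g -> chi g = 1) :
  bar_simple_class H := exist _ _ (bar_line_class_subproof h).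

Lemma one_dim_classP (D : one_dim_class A) : exists chi, sval D = iso_class (line chi).
Proof.
have [N [_ /one_dim_line[chi Nchi]] ->] := svalP D.
by exists chi; apply/iso_classP.
Qed.

Lemma sval_inj (T : Type) (P : T -> Prop) (x y : {t | P t}) : sval x = sval y -> x = y.
Proof.
by case: x y => [x px] [y py] /= e; case: _ / e py => py; rewrite (Prop_irrelevance px py).
Qed.

Lemma tmod_lineW M chi psi : chi =1 psi ->
  isomorphic (tmod H M (line chi)) (tmod H M (line psi)).
Proof. by move=> /line_iso; apply: tmod_iso; apply: isomorphic_refl. Qed.

(** That g acts by the scalar k is phrased through the element - k 1 + g of A, since
    acting by zero is visibly preserved by isomorphisms of modules. *)
Lemma bar_tmod_line M chi g k (m : M) :
    factors_through_bar H M -> central_grouplike H g ->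
  (- k *: 1 + g) *: (ptens m (line1 chi) : tmod H M (line chi)) =
  ptens (((chi g : K) - k) *: (m : restr M)) (line1 chi).
Proof.
move=> bM gG; rewrite tact_line; congr ptens.
have G1 : grouplike H 1 by split; rewrite rmorph1.
rewrite char_twistP !char_twist_grouplike ?rmorph1 ?scale1r //; last exact: gG.1.
rewrite addrC scaleNr scalerBl scalerBl; congr (_ - _).
by rewrite restr_scaleZ (bar_grouplike bM gG).
Qed.

(** The scalar by which a central group-like element acts on M (x) line chi
    recovers chi on such elements, hence chi; then chi is cancelled. *)
Lemma Phi_inj :
    (forall chi psi, (forall g, central_grouplike H g -> chi g = psi g) -> chi =1 psi) ->
  injective (@Phi K A H).
Proof.
move=> sep [C D] [C' D'] /(congr1 sval) /=.
have [M [sM bM] CE] := svalP C; have [M' [sM' bM'] CE'] := svalP C'.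
have [chi DE] := one_dim_classP D; have [psi DE'] := one_dim_classP D'.
rewrite CE CE' DE DE' !tensor_classE => /iso_classP iMM.
suff e : chi =1 psi.
  have iMM' : isomorphic M M'.
    apply: (@tmod_line_inj _ _ H _ _ psi); apply: isomorphic_trans iMM.
    by apply: tmod_lineW => a; rewrite e.
  congr pair; apply: sval_inj; rewrite ?CE ?CE' ?DE ?DE'; apply/iso_classP => //.
  exact/line_iso.
apply: sep => g gG; have [f [f' fK f'K]] := iMM.
have [[m m0] _] := sM'.
pose b : A := - (chi g : K) *: 1 + g.
have b0 (x : tmod H M (line chi)) : b *: x = 0.
  rewrite -[x]ptens_unline bar_tmod_line // subrr scale0r.
  exact: (bilin0l _ (tens_bilin (restr M) (restr (line chi)))).
have := linearZ_LR f b (f' (ptens m (line1 psi))).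
rewrite b0 raddf0 f'K bar_tmod_line // => /esym/(congr1 (@unline _ _ H M' psi)).
have u0 : unline (0 : tmod H M' (line psi)) = 0.
  by apply: (@addrI _ (unline (0 : tmod H M' (line psi)))); rewrite -unlineD !addr0.
rewrite unlineK [X in _ = X -> _]u0.
move=> mE; have : ((psi g : K) - chi g) *: (m : restr M') == 0 by apply/eqP.
by rewrite scaler_eq0 subr_eq0 (negPf m0) orbF => /eqP->.
Qed.

(** If G acts on M through chi, and psi inverts chi, then G acts trivially on
    M (x) line psi, and M is (M (x) line psi) (x) line chi. *)
Lemma Phi_surj :
    (forall M, simple M -> exists chi psi,
       (forall a, char_twist H psi (char_twist H chi a) = a) /\
       forall g, central_grouplike H g -> forall m : M, g *: m = (chi g : K) *: (m : restr M)) ->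
  forall C, exists CD, @Phi K A H CD = C.
Proof.
move=> hM C; have [M sM CE] := svalP C; have [chi [psi [inv gM]]] := hM M sM.
have bM : exists2 L : lmodType A, simple L /\ factors_through_bar H L
    & iso_class (tmod H M (line psi)) = iso_class L.
  exists (tmod H M (line psi)) => //; split.
    by apply: simple_tmod_one_dim => //; apply: line_one_dim.
  move=> x [s sG ->] y; rewrite scaler_suml big_seq big1 // => p /sG gG.
  have pG := gG.1; set g := p.2 in gG pG *.
  have chiK : (psi g : K) * (chi g : K) = 1.
    have := inv g; rewrite (char_twist_grouplike chi pG) -[_ *: g]addr0 char_twistP.
    rewrite [char_twist _ _ 0](_ : _ = 0); last first.
      by have := char_twistP H psi (-1) 0 0; rewrite scaler0 addr0 scaleN1r addNr.
    rewrite addr0 char_twist_grouplike // scalerA mulrC => /(congr1 (counit H)).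
    by rewrite linearZ /= pG.2 -[_ *: _]/(_ * _) mulr1.
  rewrite -scalerA scalerBl scale1r -[y]ptens_unline grouplike_line // gM //.
  by rewrite scalerA chiK scale1r subrr scaler0.
pose C' : bar_simple_class H := exist _ _ bM.
exists (C', line_class chi); apply: sval_inj => /=.
by rewrite tensor_classE CE; apply/iso_classP; apply: tmod_line_inv.
Qed.

(** The line of chi is at the same time a module over the quotient and a
    one-dimensional module, so it has the preimages chi (x) 1 and 1 (x) chi. *)
Lemma Phi_inj_triv chi : injective (@Phi K A H) ->
  (forall g, central_grouplike H g -> chi g = 1) -> chi =1 triv_char H.
Proof.
move=> Pinj h.
have h1 g : central_grouplike H g -> triv_char H g = 1 by move=> [[_ g1] _].
have /Pinj : Phi (bar_line_class h, line_class (triv_char H)) =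
             Phi (bar_line_class h1, line_class chi).
  apply: sval_inj; rewrite /= !tensor_classE; apply/iso_classP.
  exact: isomorphic_trans (tmod_triv H (line chi)) (isomorphic_sym (triv_tmod H chi)).
by move=> /(congr1 (fun CD => sval CD.1)) /= /iso_classP/line_iso.
Qed.

End Classes.

(** * Weight matrices *)

Section WeightMatrix.
Variables (R : comNzRingType) (n : nat).
Implicit Types (y z : R) (x : 'rV[R]_n.-1).

(** With r = theta^y and s = theta^z, omega_i e_j is theta^(W i j) e_j omega_i for
    W = weight_mx y z, and omega'_i e_j is theta^(V i j) e_j omega'_i for
    V = weight_mx z y. The matrix weight_mx 1 (-1) is the Cartan matrix of type A. *)
Definition weight_mx y z : 'M[R]_n.-1 :=
  \matrix_(i, j) (y * (pairing i j)%:~R + z * (pairing i.+1 j)%:~R).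

Lemma weight_mxB y z : weight_mx y z - weight_mx z y = (y - z) *: weight_mx 1 (-1).
Proof. by apply/matrixP => i j; rewrite !mxE; ring. Qed.

Lemma weight_mx_diag y z i : weight_mx y z i i = y - z.
Proof.
by rewrite mxE /pairing !eqxx (gtn_eqF (ltnSn i)) (ltn_eqF (ltnSn i)) /= mulr1 mulrN1.
Qed.

(** Pad x with zeros at positions 0 and n. A vector in the kernel of the Cartan
    matrix has constant differences; these n differences add up to 0, so n times
    their common value is 0. *)
Lemma cartan_ker x : (forall t : R, n%:R * t = 0 -> t = 0) ->
  x *m weight_mx 1 (-1) = 0 -> x = 0.
Proof.
move=> nreg xC.
pose X k : R := \sum_(i < n.-1) x 0 i * (i.+1 == k)%:R.
pose d k := X k.+1 - X k.
have X0 : X 0%N = 0 by rewrite /X big1 // => i _; rewrite mulr0.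
have Xn : X n = 0.
  rewrite /X big1 // => i _; case: eqP => [e|_]; last by rewrite mulr0.
  by have := ltn_ord i; rewrite -[in X in (_ < X)%N]e ltnn.
have XE (i : 'I_n.-1) : X i.+1 = x 0 i.
  rewrite /X (bigD1 i) //= eqxx mulr1 big1 ?addr0 // => k ki.
  by rewrite eqSS (inj_eq val_inj) (negPf ki) mulr0.
have dS k : (k < n.-1)%N -> d k.+1 = d k.
  move=> kn; have /rowP/(_ (Ordinal kn)) := xC; rewrite !mxE => e.
  apply/eqP; rewrite -subr_eq0 -oppr_eq0 -e /d /X -!sumrB -sumrN; apply/eqP.
  apply: eq_bigr => i _; rewrite !mxE /pairing /= !eqSS; ring.
have dc k : (k < n)%N -> d k = d 0%N.
  elim: k => // k IH kn; rewrite dS ?IH //; first by rewrite ltnW.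
  by rewrite -ltnS prednK // (leq_trans _ kn).
have d0 : d 0%N = 0.
  apply: nreg; rewrite -[RHS](subrr 0) -{1}Xn -{1}X0 -(telescope_sumr X (leq0n n)).
  rewrite big_mkord (eq_bigr (fun=> d 0%N)) => [|k _]; last by rewrite -(dc k).
  by rewrite sumr_const card_ord mulr_natl.
have Xk k : (k <= n)%N -> X k = 0.
  elim: k => // k IH kn; move: (dc k kn); rewrite d0 /d IH ?subr0 //.
  exact: ltnW.
by apply/rowP => i; rewrite mxE -XE Xk // (leq_trans (ltn_ord i)) // leq_pred.
Qed.

(** The row (1, 2, .., n - 1) paired with <epsilon_i, alpha_j> over j gives 1 for
    i < n and 1 - n for i = n; the exception disappears after multiplication by an
    element that n kills. *)
Lemma weight_mx_sum y z t : t *+ n = 0 -> forall i : 'I_n.-1,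
  t * \sum_j weight_mx y z i j * j.+1%:R = t * (y + z).
Proof.
move=> tn.
have P m : (m < n)%N -> t * \sum_(j < n.-1) (pairing m j)%:~R * j.+1%:R = t.
  move=> mn; have -> : \sum_(j < n.-1) (pairing m j)%:~R * j.+1%:R =
      \sum_(j < n.-1) (j.+1 == m.+1)%:R * m.+1%:R - \sum_(j < n.-1) (j.+1 == m)%:R * m%:R :> R.
    rewrite -sumrB; apply: eq_bigr => j _; rewrite /pairing [m == j.+1 :> nat]eq_sym.
    rewrite eqSS [j == m :> nat]eq_sym.
    case: (m =P j :> nat) => [->|_]; first by rewrite gtn_eqF //=; ring.
    by case: (j.+1 =P m :> nat) => [<-|_] /=; ring.
  have S k : (0 < k <= n)%N -> t * (\sum_(j < n.-1) (j.+1 == k)%:R * k%:R) = t * k%:R.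
    move=> /andP[k0 kn]; have [kE|kN] := eqVneq k n.
      by rewrite kE !mulr_natr tn -mulr_suml mulr_natr mulrnAr -mulrnAl tn mul0r.
    have kn1 : (k.-1 < n.-1)%N.
      by rewrite -ltnS !prednK // ?(leq_trans k0) // ltn_neqAle kN.
    rewrite (bigD1 (Ordinal kn1)) //= prednK // eqxx mul1r big1 ?addr0 // => j jk.
    case: eqP => [e|_]; last by rewrite mul0r.
    by case/eqP: jk; apply: val_inj; rewrite /= -e.
  rewrite mulrBr S; last by rewrite /= mn.
  case: m mn => [|m] mn; last first.
    rewrite S; last by rewrite /= (ltnW mn).
    by rewrite -mulrBr -natrB ?leqnSn // subSnn mulr1.
  by rewrite big1 ?mulr0 ?subr0 ?mulr1 // => j _; rewrite mulr0.
move=> i; rewrite (eq_bigr (fun j : 'I_n.-1 =>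
    y * ((pairing i j)%:~R * j.+1%:R) + z * ((pairing i.+1 j)%:~R * j.+1%:R))); last first.
  by move=> j _; rewrite mxE mulrDl !mulrA.
have ni : (i.+1 < n)%N by case: (n) i => [|[|m]] [].
rewrite big_split /= -!mulr_sumr mulrDr !(mulrCA t) !P //; last exact: ltnW.
by rewrite !(mulrC t) -mulrDl.
Qed.

(** Modulo y + z each of the n terms equals y^(n-1). *)
Lemma alternating_sumE y z : exists q,
  \sum_(i < n) (-1) ^+ i * y ^+ (n.-1 - i) * z ^+ i = y ^+ n.-1 *+ n + (y + z) * q.
Proof.
pose q i := - \sum_(k < i) (- z) ^+ (i.-1 - k) * y ^+ k.
exists (\sum_(i < n) y ^+ (n.-1 - i) * q i).
rewrite -[in X in _ *+ X](card_ord n) -sumr_const mulr_sumr -big_split /=.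
apply: eq_bigr => i _.
have -> : y ^+ n.-1 = y ^+ (n.-1 - i) * y ^+ i.
  by rewrite -exprD subnK // -ltnS (leq_trans (ltn_ord i)) // leqSpred.
rewrite mulrAC -exprNn -(subrK (y ^+ i) ((- z) ^+ i)) subrXX /q.
by set S := \sum_(_ < _) _; ring.
Qed.

End WeightMatrix.

(** On a finite set of matrices an injective right multiplication is onto, so the
    identity matrix is attained. *)
Lemma unitmx_ker0 (R : finComUnitRingType) m (A : 'M[R]_m) :
  (forall x : 'rV_m, x *m A = 0 -> x = 0) -> A \in unitmx.
Proof.
move=> A0; have Ainj : injective (fun B : 'M_m => B *m A).
  move=> B C /= e; apply/row_matrixP => i; apply/eqP; rewrite -subr_eq0; apply/eqP/A0.
  by rewrite mulmxBl -!row_mul e subrr.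
have [B BA] : exists B, B *m A = 1%:M.
  by have [g _ gK] := injF_bij Ainj; exists (g 1%:M); apply: gK.
by have [] := mulmx1_unit BA.
Qed.

(** The solutions (a, b) of aW + bV = 0 are parametrised by c = a + b: then
    b (W - V) = c W, where W - V is y - z times the Cartan matrix. *)
Lemma weight_relations (R : finComUnitRingType) n (y z : R) :
    y - z \is a GRing.unit -> n%:R \is a @GRing.unit R ->
  exists P Q : 'M[R]_n.-1,
    [/\ P + Q = 1%:M, P *m weight_mx n y z + Q *m weight_mx n z y = 0
      & forall a b : 'rV_n.-1, a *m weight_mx n y z + b *m weight_mx n z y = 0 ->
          a = (a + b) *m P /\ b = (a + b) *m Q].
Proof.
move=> yz_unit n_unit; set Y := weight_mx n y z; set Z := weight_mx n z y.
have YZu : Y - Z \in unitmx.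
  rewrite weight_mxB unitmxZ //; apply: unitmx_ker0 => x; apply: cartan_ker => t.
  by move/(congr1 (fun u => n%:R^-1 * u)); rewrite mulKr // mulr0.
pose Q := Y *m invmx (Y - Z); exists (1%:M - Q), Q.
have QYZ : Q *m (Y - Z) = Y by rewrite mulmxKV.
split=> [||a b abE]; first by rewrite subrK.
  by rewrite mulmxBl mul1mx -addrA -[Q *m Z]opprK -opprD -mulmxBr QYZ subrr.
suff bE : b = (a + b) *m Q.
  by split=> //; rewrite mulmxBr mulmx1 -bE addrK.
rewrite mulmxA -[LHS](mulmxK YZu); congr (_ *m _).
by rewrite mulmxBr mulmxDl -[RHS]subr0 -abE opprD addrACA subrr add0r.
Qed.

(** * Powers of a primitive root of unity and scalar actions *)

Lemma expr_ZpD (R : pzRingType) (l : nat) (g : R) : (1 < l)%N -> g ^+ l = 1 ->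
  forall x y : 'Z_l, g ^+ (x + y)%R = g ^+ x * g ^+ y.
Proof.
move=> l1 gl x y; rewrite -exprD /= expr_mod // Zp_cast //.
Qed.

Section RootPowers.
Variables (K : fieldType) (l : nat) (theta : K).
Hypotheses (l_gt1 : (1 < l)%N) (prim : l.-primitive_root theta).

Definition zpow (x : 'Z_l) : K := theta ^+ x.

Lemma zpow0 : zpow 0 = 1. Proof. by []. Qed.

Lemma zpowD x y : zpow (x + y) = zpow x * zpow y.
Proof. by apply: expr_ZpD => //; apply: prim_expr_order. Qed.

Lemma zpow_nat k : zpow k%:R = theta ^+ k.
Proof. by rewrite /zpow val_Zp_nat // prim_expr_mod. Qed.

Lemma zpow_neq0 x : zpow x != 0.
Proof.
rewrite expf_neq0 //; apply/eqP => t0; have := prim_expr_order prim.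
by rewrite t0 expr0n gtn_eqF ?(prim_order_gt0 prim) // => /esym/eqP; rewrite oner_eq0.
Qed.

Lemma zpowMn x k : zpow (x *+ k) = zpow x ^+ k.
Proof. by elim: k => [|k IH]; rewrite ?mulr0n // mulrS zpowD IH exprS. Qed.

Lemma zpowM x (y : 'Z_l) : zpow (x * y) = zpow x ^+ y.
Proof. by rewrite -zpowMn -[y in LHS]natr_Zp mulr_natr. Qed.

Lemma zpowN x : zpow (- x) = (zpow x)^-1.
Proof.
apply: (mulfI (zpow_neq0 x)); rewrite -zpowD subrr zpow0 divff //; exact: zpow_neq0.
Qed.

Lemma zpow_int k (m : int) : (theta ^+ k) ^ m = zpow (k%:R * m%:~R).
Proof.
case: m => m; first by rewrite mulr_natr zpowMn zpow_nat.
by rewrite NegzE mulrNz mulrN zpowN -exprnN mulr_natr zpowMn zpow_nat.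
Qed.

Lemma zpow_sum I (s : seq I) (F : I -> 'Z_l) :
  zpow (\sum_(i <- s) F i) = \prod_(i <- s) zpow (F i).
Proof. exact: (big_morph zpow zpowD zpow0). Qed.

Lemma zpow_inj : injective zpow.
Proof.
move=> x y /eqP; rewrite (eq_prim_root_expr prim) => /eqP e.
by apply: val_inj; move: e; rewrite !modn_small // -[X in (_ < X)%N](Zp_cast l_gt1) ltn_ord.
Qed.

Lemma zpow_surj x : x ^+ l = 1 -> exists k, x = zpow k.
Proof.
move=> xl; have [k ->] := prim_rootP prim xl.
by exists (k : nat)%:R; rewrite zpow_nat.
Qed.

(** Schur's lemma for a central element of finite order. The product of the
    t - theta^k is t^l - 1 = 0, so one of these factors has a nonzero kernel, which
    is a submodule. *)
Lemma simple_central_scalar (A : algType K) (M : lmodType A) (t : A) :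
    simple M -> (forall a, a * t = t * a) -> t ^+ l = 1 ->
  exists k, forall m : M, t *: m = zpow k *: (m : restr M).
Proof.
move=> [[m0 m0N] sM] tC tl.
have [[k [m [mN km]]]|noK] := pselect (exists k (m : M), m != 0 /\
    t *: m = zpow k *: (m : restr M)).
  pose S : {pred M} := fun m => `[< t *: m = zpow k *: (m : restr M) >].
  have [|h|h] := sM S.
  - split=> [|a u v]; first by apply/asboolP; rewrite !scaler0.
    move=> /asboolP Su /asboolP Sv; apply/asboolP.
    by rewrite !scalerDr scalerA -tC -scalerA Su Sv restr_scaleC.
  - have := h m; rewrite !inE (negPf mN) => /negP; case; exact/asboolP.
  - by exists k => x; have := h x; rewrite !inE => /asboolP.
have inj k (m : M) : (t - (theta ^+ k)%:A) *: m = 0 -> m = 0.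
  move=> h; apply/eqP; apply: contrapT => /negP mN; apply: noK; exists k%:R, m.
  by split=> //; apply/eqP; rewrite zpow_nat -subr_eq0 -scalerBl h.
case/eqP: m0N.
have : (horner_alg t ('X^l - 1)) *: m0 = 0.
  by rewrite rmorphB rmorphXn rmorph1 /= horner_algX tl subrr scale0r.
rewrite -(factor_Xn_sub_1 prim) rmorph_prod /=.
elim: (index_iota 0 l) => [|k ks IH]; first by rewrite big_nil scale1r.
rewrite big_cons -scalerA rmorphB /= horner_algX horner_algC.
by move=> /inj/IH.
Qed.

End RootPowers.

(** * Central group-like elements and characters of the quantum group *)

(** The facts about the restricted quantum group that the argument rests on. The
    Serre and nilpotency relations enter through the existence of modules: the lines
    given by rq_char and a module on which e_i acts nontrivially. *)
Record restricted_qg (K : fieldType) (n l : nat) (r s : K) (A : algType K) (H : hopf A)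
    (e f w v : 'I_n.-1 -> A) : Prop := RestrictedQG {
  rq_ind : forall Q : A -> Prop, Q 1 ->
    (forall k x y, Q x -> Q y -> Q (k *: x + y)) ->
    (forall i x, Q x -> [/\ Q (e i * x), Q (f i * x), Q (w i * x) & Q (v i * x)]) ->
    forall x, Q x;
  rq_comm : forall i j, [/\ w i * w j = w j * w i, w i * v j = v j * w i
                          & v i * v j = v j * v i];
  rq_order : forall i, w i ^+ l = 1 /\ v i ^+ l = 1;
  rq_we : forall i j : 'I_n.-1,
    w i * e j = (r ^ pairing i j * s ^ pairing i.+1 j) *: (e j * w i);
  rq_wf : forall i j : 'I_n.-1,
    w i * f j = (r ^ (- pairing i j) * s ^ (- pairing i.+1 j)) *: (f j * w i);
  rq_ve : forall i j : 'I_n.-1,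
    v i * e j = (r ^ pairing i.+1 j * s ^ pairing i j) *: (e j * v i);
  rq_vf : forall i j : 'I_n.-1,
    v i * f j = (r ^ (- pairing i.+1 j) * s ^ (- pairing i j)) *: (f j * v i);
  rq_ef : forall i, e i * f i - f i * e i = (r - s)^-1 *: (w i - v i);
  rq_e_neq0 : forall i, e i != 0;
  rq_char : forall x : 'I_n.-1 -> K, (forall i, x i ^+ l = 1) ->
    exists chi : {lrmorphism A -> K^o}, forall i, chi (w i) = x i;
  rq_comul : forall i, [/\ comul H (w i) = tens (w i) (w i), comul H (v i) = tens (v i) (v i),
    comul H (e i) = tens (e i) 1 + tens (w i) (e i)
    & comul H (f i) = tens 1 (f i) + tens (f i) (v i)]
}.

Section QuantumGroup.
Variables (K : fieldType) (n l y z : nat) (theta : K) (A : algType K) (H : hopf A).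
Variables (e f w v : 'I_n.-1 -> A).
Hypotheses (l_gt1 : (1 < l)%N) (prim : l.-primitive_root theta).
Local Notation r := (theta ^+ y).
Local Notation s := (theta ^+ z).
Hypothesis rs : r != s.
Hypothesis qg : restricted_qg l r s H e f w v.
Local Notation zpow := (@zpow K l theta).
Local Notation W := (weight_mx n (y%:R : 'Z_l) z%:R).
Local Notation V := (weight_mx n (z%:R : 'Z_l) y%:R).
Implicit Types (a b : 'rV['Z_l]_n.-1) (chi psi : {lrmorphism A -> K^o}).

Lemma qg_we i j : w i * e j = zpow (W i j) *: (e j * w i).
Proof. by rewrite (rq_we qg) !(zpow_int l_gt1 prim) -zpowD // mxE. Qed.

Lemma qg_wf i j : w i * f j = zpow (- W i j) *: (f j * w i).
Proof.
by rewrite (rq_wf qg) !(zpow_int l_gt1 prim) -zpowD // !mulrNz !mulrN -opprD mxE.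
Qed.

Lemma qg_ve i j : v i * e j = zpow (V i j) *: (e j * v i).
Proof. by rewrite (rq_ve qg) !(zpow_int l_gt1 prim) -zpowD // mxE addrC. Qed.

Lemma qg_vf i j : v i * f j = zpow (- V i j) *: (f j * v i).
Proof.
by rewrite (rq_vf qg) !(zpow_int l_gt1 prim) -zpowD // !mulrNz !mulrN -opprD mxE addrC.
Qed.

(** The toral element omega^a omega'^b, with exponents in Z/l. *)
Definition tor a b : A := \prod_i (w i ^+ a 0 i * v i ^+ b 0 i).

Lemma prod_split_comm I (t : seq I) (F G : I -> A) :
    (forall i j, GRing.comm (F i) (G j)) ->
  \prod_(i <- t) (F i * G i) = (\prod_(i <- t) F i) * \prod_(i <- t) G i.
Proof.
move=> FG; elim: t => [|i t IH]; first by rewrite !big_nil mulr1.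
rewrite !big_cons IH !mulrA; congr (_ * _); rewrite -!mulrA; congr (_ * _).
by apply: commr_prod => j _; apply/commr_sym/FG.
Qed.

Lemma torD a b a' b' : tor (a + a') (b + b') = tor a b * tor a' b'.
Proof.
rewrite /tor -prod_split_comm => [|i j]; last first.
  have [ww wv vv] := rq_comm qg i j; have [_ vw _] := rq_comm qg j i.
  have X (t u : A) p q : t * u = u * t -> GRing.comm (t ^+ p) (u ^+ q).
    by move=> tu; apply/commrX/commr_sym/commrX.
  by apply/commrM; apply/commr_sym/commrM; apply: X.
apply: eq_bigr => i _; have [wl vl] := rq_order qg i.
rewrite !mxE !expr_ZpD // !mulrA; congr (_ * _); rewrite -!mulrA; congr (_ * _).
by have [_ wv _] := rq_comm qg i i; apply/commrX/commr_sym/commrX/commr_sym.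
Qed.

Lemma tor0 : tor 0 0 = 1.
Proof. by rewrite /tor big1 // => i _; rewrite !mxE mulr1. Qed.

Lemma torMn a b k : tor (a *+ k) (b *+ k) = tor a b ^+ k.
Proof. by elim: k => [|k IH]; rewrite ?mulr0n ?tor0 // !mulrS torD IH exprS. Qed.

Lemma tor_order a b : tor a b ^+ l = 1.
Proof.
have l0 (c : 'rV['Z_l]_n.-1) : c *+ l = 0.
  by apply/rowP => i; rewrite mulmxnE mxE -mulr_natr pchar_Zp // mulr0.
by rewrite -torMn !l0 tor0.
Qed.

Lemma torN a b : tor a b * tor (- a) (- b) = 1.
Proof. by rewrite -torD !subrr tor0. Qed.

Lemma tor_sum I (t : seq I) (F G : I -> 'rV['Z_l]_n.-1) :
  tor (\sum_(i <- t) F i) (\sum_(i <- t) G i) = \prod_(i <- t) tor (F i) (G i).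
Proof.
elim: t => [|i t IH]; first by rewrite !big_nil tor0.
by rewrite !big_cons torD IH.
Qed.

Lemma prod_delta (F : 'I_n.-1 -> A) i :
  \prod_j F j ^+ (delta_mx 0 i : 'rV['Z_l]_n.-1) 0 j = F i.
Proof.
transitivity (\prod_(j | j == i) F j); last by rewrite big_pred1_eq.
by rewrite [RHS]big_mkcond; apply: eq_bigr => j _; rewrite mxE eqxx /=; case: eqP.
Qed.

Lemma tor_w i : tor (delta_mx 0 i) 0 = w i.
Proof.
rewrite -[RHS](prod_delta w); apply: eq_bigr => j _.
by rewrite (_ : (0 : 'rV['Z_l]_n.-1) 0 j = 0) ?mulr1 // mxE.
Qed.

Lemma tor_v i : tor 0 (delta_mx 0 i) = v i.
Proof.
rewrite -[RHS](prod_delta v); apply: eq_bigr => j _.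
by rewrite (_ : (0 : 'rV['Z_l]_n.-1) 0 j = 0) ?mul1r // mxE.
Qed.

Lemma qcommM (c d : K) (t t' u : A) : t * u = c *: (u * t) -> t' * u = d *: (u * t') ->
  (t * t') * u = (c * d) *: (u * (t * t')).
Proof.
move=> tu t'u; rewrite -mulrA t'u -scalerAr (mulrA t) tu -scalerAl scalerA mulrC.
by rewrite !mulrA.
Qed.

Lemma qcommX (c : K) (t u : A) k : t * u = c *: (u * t) -> t ^+ k * u = c ^+ k *: (u * t ^+ k).
Proof.
move=> tu; elim: k => [|k IH]; first by rewrite !expr0 mul1r mulr1 scale1r.
by rewrite !exprS; apply: qcommM.
Qed.

Lemma tor_qcomm u (c d : 'I_n.-1 -> 'Z_l) a b :
    (forall i, w i * u = zpow (c i) *: (u * w i)) ->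
    (forall i, v i * u = zpow (d i) *: (u * v i)) ->
  tor a b * u = zpow (\sum_i (a 0 i * c i + b 0 i * d i)) *: (u * tor a b).
Proof.
move=> wu vu; rewrite zpow_sum // /tor.
apply: (big_ind2 (fun t k => t * u = k *: (u * t))) => [|t c' t' d'|i _].
- by rewrite mul1r mulr1 scale1r.
- exact: qcommM.
- rewrite zpowD // !(mulrC _ (c i)) !(mulrC _ (d i)) !zpowM //.
  by apply: qcommM; apply: qcommX.
Qed.

Lemma tor_e a b j : tor a b * e j = zpow ((a *m W + b *m V) 0 j) *: (e j * tor a b).
Proof.
rewrite (tor_qcomm a b (fun i => qg_we i j) (fun i => qg_ve i j)); congr (zpow _ *: _).
by rewrite big_split !mxE.
Qed.

Lemma tor_f a b j : tor a b * f j = zpow (- (a *m W + b *m V) 0 j) *: (f j * tor a b).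
Proof.
rewrite (tor_qcomm a b (fun i => qg_wf i j) (fun i => qg_vf i j)); congr (zpow _ *: _).
rewrite big_split !mxE opprD -!sumrN; congr (_ + _); apply: eq_bigr => i _; exact: mulrN.
Qed.

Lemma tor_mulC a b a' b' : tor a b * tor a' b' = tor a' b' * tor a b.
Proof. by rewrite -!torD addrC [b + _]addrC. Qed.

Lemma tor_central a b : a *m W + b *m V = 0 -> forall u, u * tor a b = tor a b * u.
Proof.
move=> ab0; apply: (rq_ind qg) => [|k t u tC uC|i u uC].
- by rewrite mul1r mulr1.
- by rewrite mulrDl mulrDr -scalerAl -scalerAr tC uC.
- split; rewrite -mulrA uC !mulrA; congr (_ * _).
  + by rewrite tor_e ab0 mxE scale1r.
  + by rewrite tor_f ab0 mxE oppr0 scale1r.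
  + by rewrite -tor_w tor_mulC.
  + by rewrite -tor_v tor_mulC.
Qed.

Lemma central_tor a b : (forall u, u * tor a b = tor a b * u) -> a *m W + b *m V = 0.
Proof.
move=> C; apply/rowP => j; apply: (zpow_inj l_gt1 prim); rewrite [RHS](_ : _ = 1); last by rewrite mxE.
have := tor_e a b j; rewrite -C => /eqP.
rewrite -subr_eq0 -[X in X - _]scale1r -scalerBl scaler_eq0 => /orP[|/eqP et].
  by rewrite subr_eq0 => /eqP<-.
by case/eqP: (rq_e_neq0 qg j); rewrite -[e j]mulr1 -(torN a b) mulrA et mul0r.
Qed.

Lemma tor_grouplike a b : grouplike H (tor a b).
Proof.
have DT : comul H (tor a b) = tens (tor a b) (tor a b).
  apply: (big_ind (fun t => comul H t = tens t t)) => [|t u tG uG|i _].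
  - by rewrite rmorph1.
  - by rewrite rmorphM /= tG uG tensM.
  - have [wG vG _ _] := rq_comul qg i.
    have X t k : comul H t = tens t t -> comul H (t ^+ k) = tens (t ^+ k) (t ^+ k).
      move=> tG; rewrite rmorphXn /= tG; elim: k => // k IH.
      by rewrite !exprS IH tensM.
    by rewrite rmorphM /= !X // tensM.
split=> //; have := counitl H (tor a b); rewrite DT.
rewrite (tlift_tens _ _ (functional_bilinl (counit H))) => tE.
have : (counit H (tor a b) : K) *: (1 : A) = 1 by rewrite -(torN a b) scalerAl tE.
by move=> /(congr1 (counit H)); rewrite linearZ /= rmorph1 -[_ *: _]/(_ * _) mulr1.
Qed.

Lemma grouplike_tor g : grouplike H g -> exists a b, g = tor a b.
Proof.
pose T t := exists a b, t = tor a b.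
pose X t := exists i, t = e i \/ t = f i.
apply: (@grouplike_pointed _ _ H T X).
- by exists 0, 0; rewrite tor0.
- by move=> _ _ [a [b ->]] [a' [b' ->]]; exists (a + a'), (b + b'); rewrite torD.
- by move=> _ [a [b ->]]; apply: tor_grouplike.
- have T1 : T 1 by exists 0, 0; rewrite tor0.
  move=> _ [i [->|->]]; have [_ _ De Df] := rq_comul qg i.
    by exists 1, (w i); split=> //; exists (delta_mx 0 i), 0; rewrite tor_w.
  exists (v i), 1; split=> //; last by rewrite addrC.
  by exists 0, (delta_mx 0 i); rewrite tor_v.
apply: (rq_ind qg) => [|k t u [p tp] [q uq]|i t [p tp]].
- by exists 0%N; apply: filt1.
- exists (maxn p q); apply: filt_lin; last by apply: filtW uq; rewrite leq_maxr.
  by apply: filtW tp; rewrite leq_maxl.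
- split; [exists p.+1 | exists p.+1 | exists p | exists p].
  + by apply: filtX => //; exists i; left.
  + by apply: filtX => //; exists i; right.
  + by apply: filtT => //; exists (delta_mx 0 i), 0; rewrite tor_w.
  + by apply: filtT => //; exists 0, (delta_mx 0 i); rewrite tor_v.
Qed.

(** Centrality is tested on the e_j alone: aW + bV = 0 also makes the toral element
    commute with the f_j, and e_j being nonzero gives the converse. *)
Lemma central_grouplikeP g : central_grouplike H g <->
  exists a b, g = tor a b /\ a *m W + b *m V = 0.
Proof.
split=> [[/grouplike_tor[a [b ->]] C]|[a [b [-> ab0]]]].
  by exists a, b; split=> //; apply: central_tor.
by split; [apply: tor_grouplike | apply: tor_central].
Qed.

Lemma tor_counit a b : counit H (tor a b) = 1.
Proof. by have [] := tor_grouplike a b. Qed.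

Lemma char_w chi i : exists k, chi (w i) = zpow k.
Proof.
apply: (zpow_surj l_gt1 prim); have [wl _] := rq_order qg i.
by rewrite -[_ ^+ l](rmorphXn chi) /= wl rmorph1.
Qed.

(** omega_i e_i = (r / s) e_i omega_i, where r / s is not 1 and omega_i is invertible. *)
Lemma char_e chi i : chi (e i) = 0.
Proof.
have [k wk] := char_w chi i; have /(congr1 chi) := qg_we i i.
rewrite linearZ /= !rmorphM /= -[_ *: _]/(_ * _) (mulrC (chi (e i))) mulrA => /eqP.
rewrite -subr_eq0 -mulrBl mulf_eq0 => /orP[|/eqP//].
rewrite -[X in X - _]mul1r -mulrBl mulf_eq0 wk (negPf (zpow_neq0 prim k)) orbF.
rewrite subr_eq0 -(zpow0 l theta) => /eqP/(zpow_inj l_gt1 prim)/esym/eqP.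
rewrite weight_mx_diag subr_eq0.
by move=> /eqP/(congr1 zpow); rewrite !zpow_nat // => /eqP; rewrite (negPf rs).
Qed.

Lemma char_f chi i : chi (f i) = 0.
Proof.
have [k wk] := char_w chi i; have /(congr1 chi) := qg_wf i i.
rewrite linearZ /= !rmorphM /= -[_ *: _]/(_ * _) (mulrC (chi (f i))) mulrA => /eqP.
rewrite -subr_eq0 -mulrBl mulf_eq0 => /orP[|/eqP//].
rewrite -[X in X - _]mul1r -mulrBl mulf_eq0 wk (negPf (zpow_neq0 prim k)) orbF.
rewrite subr_eq0 -(zpow0 l theta) => /eqP/(zpow_inj l_gt1 prim)/esym/eqP.
rewrite oppr_eq0 weight_mx_diag subr_eq0.
by move=> /eqP/(congr1 zpow); rewrite !zpow_nat // => /eqP; rewrite (negPf rs).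
Qed.

(** Apply chi to the commutator of e_i and f_i. *)
Lemma char_v chi i : chi (v i) = chi (w i).
Proof.
have /(congr1 chi) := rq_ef qg i; rewrite raddfB linearZ /= !rmorphM /= !char_e !char_f.
rewrite mulr0 subrr -[_ *: _]/(_ * _) raddfB => /esym/eqP; rewrite mulf_eq0 invr_eq0.
by rewrite subr_eq0 (negPf rs) /= subr_eq0 => /eqP.
Qed.

Lemma char_ext chi psi : (forall i, chi (w i) = psi (w i)) -> chi =1 psi.
Proof.
move=> wE; apply: (rq_ind qg) => [|k t u tE uE|i t tE]; first by rewrite !rmorph1.
  by rewrite !linearP /= tE uE.
by split; rewrite !rmorphM /= tE ?char_v ?wE // ?char_e ?char_f.
Qed.

Lemma char_tor chi (x : 'I_n.-1 -> 'Z_l) a b : (forall i, chi (w i) = zpow (x i)) ->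
  chi (tor a b) = zpow (\sum_i x i * (a + b) 0 i).
Proof.
move=> wx; rewrite rmorph_prod zpow_sum //=; apply: eq_bigr => i _.
by rewrite mxE rmorphM !rmorphXn /= char_v wx mulrDr zpowD // !zpowM.
Qed.

Lemma char_exists (x : 'I_n.-1 -> 'Z_l) :
  exists chi : {lrmorphism A -> K^o}, forall i, chi (w i) = zpow (x i).
Proof.
apply: (rq_char qg) => i; rewrite -zpowMn // -mulr_natr pchar_Zp // mulr0.
exact: zpow0.
Qed.

(** The twist by chi scales omega_i, omega'_i and f_i by chi(omega_i) and fixes e_i. *)
Lemma twist_inv chi psi (x : 'I_n.-1 -> 'Z_l) :
    (forall i, chi (w i) = zpow (x i)) -> (forall i, psi (w i) = zpow (- x i)) ->
  forall t, char_twist H psi (char_twist H chi t) = t.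
Proof.
move=> chix psix.
have twZ eta (k : K) t : char_twist H eta (k *: t) = k *: char_twist H eta t.
  have t0 : char_twist H eta 0 = 0.
    by have := char_twistP H eta (-1) 0 0; rewrite scaler0 addr0 scaleN1r addNr.
  by rewrite -[k *: t]addr0 char_twistP t0 addr0.
have tw_tens (eta : {lrmorphism A -> K^o}) (t u : A) :
    tlift (fun t1 t2 : A => (eta t2 : K) *: t1) (tens t u) = (eta u : K) *: t.
  by rewrite tlift_tens //; apply: char_twist_bilin.
have G1 : grouplike H 1 by split; rewrite rmorph1.
have twe eta i : char_twist H eta (e i) = e i.
  have [_ _ De _] := rq_comul qg i; rewrite /char_twist De.
  rewrite -[tens (e i) 1]scale1r (tlift_linear (char_twist_bilin eta)) !tw_tens.
  by rewrite char_e rmorph1 !scale1r scale0r addr0.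
have twf eta i : char_twist H eta (f i) = eta (w i) *: f i.
  have [_ _ _ Df] := rq_comul qg i; rewrite /char_twist Df.
  rewrite -[tens 1 _]scale1r (tlift_linear (char_twist_bilin eta)) !tw_tens.
  by rewrite char_f char_v scale0r scaler0 add0r.
have tww eta i : char_twist H eta (w i) = eta (w i) *: w i.
  by rewrite char_twist_grouplike // -tor_w; apply: tor_grouplike.
have twv eta i : char_twist H eta (v i) = eta (w i) *: v i.
  by rewrite char_twist_grouplike ?char_v // -tor_v; apply: tor_grouplike.
have inv i : chi (w i) * psi (w i) = 1 :> K.
  by rewrite chix psix -zpowD // subrr.
apply: (rq_ind qg) => [|k t u tE uE|i t tE].
- by rewrite !char_twist_grouplike // ?rmorph1 ?scale1r ?char_twist_grouplike // rmorph1 scale1r.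
- by rewrite !char_twistP tE uE.
- rewrite !char_twistM tE !(twe, twf, tww, twv) !twZ !(twe, twf, tww, twv) !scalerA !inv.
  by rewrite !scale1r.
Qed.

(** The character with all exponents t = l/p is trivial on the central group-like
    elements: q below is the sum of the entries of a + b, and t q = 0 as t q is
    annihilated by n and by y + z, hence by the alternating sum, which is a unit. *)
Lemma Phi_not_injective p : prime p -> (p %| n)%N -> (p %| l)%N -> (1 < n)%N ->
    (\sum_(i < n) (-1) ^+ i * y%:R ^+ (n.-1 - i) * z%:R ^+ i : 'Z_l) \is a GRing.unit ->
  ~ injective (@Phi K A H).
Proof.
move=> p_pr pn pl n_gt1 Du Pinj; pose t : 'Z_l := (l %/ p)%:R.
have lm0 : l%:R = 0 :> 'Z_l by rewrite pchar_Zp.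
have tn : t *+ n = 0.
  rewrite /t -mulrnA; case/dvdnP: pn => k ->.
  by rewrite (mulnC k) mulnA divnK // natrM lm0 mul0r.
have tN0 : t != 0.
  rewrite -val_eqE /= val_Zp_nat // modn_small ?ltn_Pdiv ?prime_gt1 ?(ltnW l_gt1) //.
  by rewrite -lt0n divn_gt0 ?prime_gt0 // dvdn_leq // ltnW.
have [chi chit] := char_exists (fun=> t).
have chi1 : chi =1 triv_char H.
  apply: Phi_inj_triv => // g /central_grouplikeP[a [b [-> ab0]]].
  rewrite (char_tor a b chit) -mulr_sumr; set q := \sum_i _.
  suff -> : t * q = 0 by [].
  have qyz : t * (y%:R + z%:R) * q = 0.
    have : \sum_j (a *m W + b *m V) 0 j * (t * j.+1%:R) = 0.
      by rewrite ab0 big1 // => j _; rewrite mxE mul0r.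
    move=> <-; rewrite /q mulr_sumr.
    rewrite [RHS](eq_bigr (fun j => \sum_i (a 0 i * (t * (W i j * j.+1%:R))
                                    + b 0 i * (t * (V i j * j.+1%:R))))); last first.
      have mulE (c : 'rV['Z_l]_n.-1) (B : 'M_n.-1) j : (c *m B) 0 j = \sum_i c 0 i * B i j.
        by rewrite mxE.
      move=> j _; rewrite mxE !mulE mulrDl !mulr_suml -big_split; apply: eq_bigr => i _.
      by rewrite /= !(mulrCA t) !mulrA.
    rewrite exchange_big; apply: eq_bigr => i _; rewrite big_split /= -!mulr_sumr.
    by rewrite !weight_mx_sum // mxE (addrC z%:R) -mulrDl mulrC.
  have [k] := alternating_sumE n (y%:R : 'Z_l) z%:R => DE.
  apply: (mulrI Du); rewrite mulr0 DE mulrDl -mulr_natr.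
  rewrite -mulrA [n%:R * _]mulrA mulr_natl tn mul0r mulr0 add0r.
  by rewrite [_ * k]mulrC -mulrA [X in k * X]mulrCA mulrA qyz mulr0.
have n1 : (0 < n.-1)%N by rewrite -ltnS prednK // ltnW.
have := chi1 (w (Ordinal n1)); rewrite chit -tor_w tor_counit -[RHS](zpow0 l theta).
by move/(zpow_inj l_gt1 prim)/eqP; rewrite (negPf tN0).
Qed.

(** The rows of P and Q give central group-like elements g_k with a + b the k-th unit
    vector. They generate all central group-like elements, and chi(g_k) =
    chi(omega_k) for every character chi; so a character is determined by its
    values on the g_k, and these values are arbitrary l-th roots of unity. *)
Lemma Phi_bijective : (y%:R - z%:R : 'Z_l) \is a GRing.unit ->
  n%:R \is a @GRing.unit 'Z_l -> bijective (@Phi K A H).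
Proof.
move=> yzu nu; have [P [Q [PQ PWQV abPQ]]] := weight_relations yzu nu.
pose g k := tor (row k P) (row k Q).
have gC k : central_grouplike H (g k).
  apply/central_grouplikeP; exists (row k P), (row k Q); split=> //.
  by rewrite -!row_mul -raddfD PWQV raddf0.
have char_g chi k : chi (g k) = chi (w k).
  have /choice[x wx] := char_w chi.
  rewrite wx (char_tor _ _ wx) -raddfD PQ; congr zpow.
  rewrite (bigD1 k) //= big1 => [|i ik]; first by rewrite !mxE eqxx mulr1 addr0.
  by rewrite !mxE eq_sym (negPf ik) mulr0.
have Pinj : injective (@Phi K A H).
  by apply: Phi_inj => chi psi cE; apply: char_ext => i; rewrite -!char_g cE.
have Psurj : forall C, exists CD, @Phi K A H CD = C.
  apply: Phi_surj => M sM.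
  have /choice[x gx] k : exists x, forall m : M, g k *: m = zpow x *: (m : restr M).
    apply: simple_central_scalar => //; last exact: tor_order.
    by move=> a; exact: (gC k).2.
  have [chi chix] := char_exists x; have [psi psix] := char_exists (fun i => - x i).
  exists chi, psi; split; first exact: twist_inv chix psix.
  move=> _ /central_grouplikeP[a [b [-> ab0]]] m; rewrite (char_tor a b chix).
  have [aE bE] := abPQ a b ab0; set c := a + b in aE bE *.
  have rowE (B : 'M['Z_l]_n.-1) : c *m B = \sum_k row k B *+ c 0 k.
    rewrite mulmx_sum_row; apply: eq_bigr => k _.
    by rewrite -[in LHS](natr_Zp (c 0 k)) scaler_nat.
  rewrite aE bE !rowE tor_sum zpow_sum //.
  rewrite (eq_bigr (fun k => g k ^+ c 0 k)) => [|k _]; last exact: torMn.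
  elim: (index_enum _) m => [|k ks IH] m; first by rewrite !big_nil !scale1r.
  rewrite !big_cons -scalerA IH restr_scaleC.
  rewrite [RHS](_ : _ = (\prod_(j <- ks) zpow (x j * c 0 j)) *: ((zpow (x k * c 0 k) *: (m : restr M)))); last first.
    by rewrite scalerA mulrC.
  congr (_ *: _); rewrite zpowM //.
  elim: (c 0 k : nat) => [|j IHj]; first by rewrite !expr0 !scale1r.
  by rewrite !exprSr -scalerA gx restr_scaleC IHj scalerA mulrC.
have /choice[h hK] := Psurj; exists h => // CD.
by apply: Pinj; rewrite hK.
Qed.

End QuantumGroup.

(** * The presentation of the restricted quantum group *)

Section FreeAlgebra.
Variables (K : fieldType) (X : choiceType).

Lemma malg_word (m : seq X) :
  (<< FMonom m >> : {malg K[{fmonom X}]}) = \prod_(x <- m) free_gen K x :> free_alg K X.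
Proof.
elim: m => [|x m IH].
  rewrite big_nil; congr mkmalgU; apply/eqP; rewrite fmP; apply/eqP.
  by rewrite fm1.
rewrite big_cons -IH free_mulE free_gen.unlock malgM_def fgmulUU mulr1.
by congr mkmalgU; apply/eqP; rewrite fmP; apply/eqP; rewrite fmM fmU.
Qed.

Lemma free_alg_ind (Q : free_alg K X -> Prop) : Q 1 ->
  (forall k a b, Q a -> Q b -> Q (k *: a + b)) ->
  (forall x a, Q a -> Q (free_gen K x * a)) -> forall a, Q a.
Proof.
move=> Q1 QL QM a.
have Q0 : Q 0 by have := QL (-1) 1 1 Q1 Q1; rewrite scaleN1r addNr.
rewrite [a]monalgE; elim: (X in \sum_(_ <- X) _) => [|m ms IH]; first by rewrite big_nil.
rewrite big_cons.
have -> : << a@_m *g m >> = a@_m *: (\prod_(x <- (m : seq X)) free_gen K x) :> free_alg K X.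
  rewrite -malg_word free_scaleE; apply/malgP => m'; rewrite mcoeffZ !mcoeffU.
  by rewrite mulr_natr; case: m.
apply: QL => //; elim: (m : seq X) => [|x w IHw]; first by rewrite big_nil.
by rewrite big_cons; apply: QM.
Qed.

End FreeAlgebra.

Section Presentation.
Variables (K : fieldType) (n : nat) (r s : K) (l : nat) (l_gt0 : (0 < l)%N).
Local Notation F := (free_alg K (qg_gen n)).
Local Notation u := (u n r s l_gt0).
Local Notation ugen := (@ugen K n r s l l_gt0).

Definition upi : F -> u := qproj (u_proper n r s l_gt0) \o qproj (U_proper n r s).

HB.instance Definition _ := GRing.LRMorphism.on upi.

Lemma upi_gen x : upi (free_gen K x) = ugen x.
Proof. by []. Qed.

Lemma upi_relator a : U_relator r s a -> upi a = 0.
Proof. by move=> /(qproj_eq0 (U_proper n r s)) a0; rewrite /upi /= a0 raddf0. Qed.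

Lemma u_ind (Q : u -> Prop) : Q 1 ->
  (forall k a b, Q a -> Q b -> Q (k *: a + b)) ->
  (forall x a, Q a -> Q (ugen x * a)) -> forall a, Q a.
Proof.
move=> Q1 QL QM a; rewrite -[a]qreprK -[qrepr a]qreprK.
move: (qrepr (qrepr a)) => {}a; rewrite -[qproj _ _]/(upi a).
elim/free_alg_ind: a => [|k a b Qa Qb|x a Qa].
- by rewrite rmorph1.
- by rewrite linearP; apply: QL.
- by rewrite rmorphM; apply: QM.
Qed.

Lemma U_lift (B : algType K) (rho : qg_gen n -> B) :
    (forall a, U_relator r s a -> free_eval rho a = 0) ->
  exists phi : {lrmorphism U n r s -> B}, forall x, phi (Ugen r s x) = rho x.
Proof.
move=> h; exists (qlift (P_proper := U_proper n r s) h) => x.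
transitivity (free_eval rho (free_gen K x)); last exact: free_evalE.
exact: qlift_proj.
Qed.

Lemma u_lift (B : algType K) (phi : {lrmorphism U n r s -> B}) :
    (forall a, u_relator l a -> phi a = 0) ->
  exists psi : {lrmorphism u -> B}, forall x, psi (ugen x) = phi (Ugen r s x).
Proof.
by move=> h; exists (qlift (P_proper := u_proper n r s l_gt0) h) => x; apply: qlift_proj.
Qed.

Definition char_gen (x : 'I_n.-1 -> K) (g : qg_gen n) : K^o :=
  match g with
  | Ge _ | Gf _ => 0
  | Gw i | Gv i => x i
  | GwV i | GvV i => (x i)^-1
  end.

Lemma char_relator (x : 'I_n.-1 -> K) : (forall i, x i != 0) ->
  forall a, U_relator r s a -> free_eval (char_gen x) a = 0.
Proof.
move=> x0 a; pose rho := char_gen x; rewrite -/rho.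
pose h : F -> K^o := free_eval rho; rewrite -[free_eval _ a]/(h a).
have hB x' y : h (x' - y) = h x' - h y by rewrite /h rmorphB.
have hD x' y : h (x' + y) = h x' + h y by rewrite /h rmorphD.
have hM x' y : h (x' * y) = h x' * h y by rewrite /h rmorphM.
have hZ k x' : h (k *: x') = k * h x' by rewrite /h linearZ.
have h1 : h 1 = 1 by rewrite /h rmorph1.
have hg x' : h (free_gen K x') = rho x' by rewrite /h free_evalE.
move: h hB hD hM hZ h1 hg => h hB hD hM hZ h1 hg.
case=> {a} [g g' _ _|i|i|i j|i j|i j|i j|i j|i j _|i j _|i j _|i j _|i j _|i j _].
- by rewrite hB !hM mulrC subrr.
- by rewrite hB hM !hg h1 /= divff // subrr.
- by rewrite hB hM !hg h1 /= divff // subrr.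
- by rewrite hB hZ !hM !hg /= mulr0 mul0r mulr0 subrr.
- by rewrite hB hZ !hM !hg /= mulr0 mul0r mulr0 subrr.
- by rewrite hB hZ !hM !hg /= mulr0 mul0r mulr0 subrr.
- by rewrite hB hZ !hM !hg /= mulr0 mul0r mulr0 subrr.
- by rewrite !hB hZ !hB !hM !hg /= !mulr0 !subrr mulr0 subrr.
- by rewrite hB !hM !hg /= mulr0 subrr.
- by rewrite hB !hM !hg /= mulr0 subrr.
- by rewrite !expr2 hD hB !hZ !hM !hg /= !mulr0 subrr addr0.
- by rewrite !expr2 hD hB !hZ !hM !hg /= !mulr0 subrr addr0.
- by rewrite !expr2 hD hB !hZ !hM !hg /= !mulr0 subrr addr0.
- by rewrite !expr2 hD hB !hZ !hM !hg /= !mulr0 subrr addr0.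
Qed.

Lemma u_char (x : 'I_n.-1 -> K) : (forall i, x i ^+ l = 1) ->
  exists chi : {lrmorphism u -> K^o}, forall i, chi (ugen (Gw i)) = x i.
Proof.
move=> xl; have l0 : (l == 0)%N = false by rewrite eqn0Ngt l_gt0.
have x0 i : x i != 0.
  by apply/eqP => xi; have /esym/eqP := xl i; rewrite xi expr0n l0 oner_eq0.
have [h hg] := U_lift (char_relator x0).
have [|chi chiE] := @u_lift _ h; last by exists chi => i; rewrite chiE hg.
have root0 c (e : 'I_n.-1 -> U n r s) i j : (forall i, h (e i) = 0) ->
    h (rootvec c (ext e) i j) = 0.
  move=> e0; have ext0 k : h (ext e k) = 0.
    by rewrite /ext; case: insub => [k'|] /=; rewrite ?e0 // raddf0.
  elim: i => [|i IHi] /=; first exact: ext0.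
  have hZM k a b : h (k *: (a * b)) = k * (h a * h b) by rewrite linearZ /= rmorphM.
  by case: ifP => _ //; rewrite rmorphB /= hZM rmorphM /= ext0 mul0r mulr0 mulr0 subrr.
move=> _ [i j _|i j _|i|i].
- by rewrite rmorphXn /= /Defs.rootE root0 ?expr0n ?l0 // => k; rewrite hg.
- by rewrite rmorphXn /= /Defs.rootF root0 ?expr0n ?l0 // => k; rewrite hg.
- by rewrite rmorphB rmorph1 rmorphXn /= hg /= xl subrr.
- by rewrite rmorphB rmorph1 rmorphXn /= hg /= xl subrr.
Qed.

End Presentation.

(** * The natural representation *)

Section NaturalRepresentation.
Variables (K : fieldType) (m : nat) (r s : K) (l : nat).
Hypotheses (l_gt1 : (1 < l)%N) (rl : r ^+ l = 1) (sl : s ^+ l = 1) (rs : r != s).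
Local Notation M := 'M[K]_m.+1.

Definition munit (i j : nat) : M := delta_mx (inord i) (inord j).

Definition diag (g : nat -> K) : M := diag_mx (\row_k g k).

Lemma munitM i j k p : (j <= m)%N -> (k <= m)%N ->
  munit i j * munit k p = if j == k then munit i p else 0.
Proof.
move=> jm km; rewrite -[LHS]/(_ *m _) mul_delta_mx_cond -val_eqE /= !inordK //.
by case: eqP.
Qed.

Lemma diagM g h : diag g * diag h = diag (fun k => g k * h k).
Proof.
rewrite -[LHS]/(_ *m _) mulmx_diag; congr diag_mx.
by apply/rowP => k; rewrite !mxE.
Qed.

Lemma diag1 : diag (fun=> 1) = 1.
Proof. by apply/matrixP => i j; rewrite !mxE. Qed.

Lemma diagX g k : diag g ^+ k = diag (fun i => g i ^+ k).
Proof.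
elim: k => [|k IH]; first by rewrite expr0 -diag1.
by rewrite exprS IH diagM; congr diag_mx; apply/rowP => i; rewrite !mxE exprS.
Qed.

Lemma eq_diag g h : (forall k, (k <= m)%N -> g k = h k) -> diag g = diag h.
Proof. by move=> gh; congr diag_mx; apply/rowP => k; rewrite !mxE gh // -ltnS ltn_ord. Qed.

Lemma diag_munit g i j : (i <= m)%N -> diag g * munit i j = g i *: munit i j.
Proof.
move=> im; apply/matrixP => a b; rewrite -[_ * _]/(_ *m _) mul_diag_mx !mxE.
by case: eqP => [->|_]; rewrite ?inordK //= !mulr0.
Qed.

Lemma munit_diag g i j : (j <= m)%N -> munit i j * diag g = g j *: munit i j.
Proof.
move=> jm; apply/matrixP => a b; rewrite -[_ * _]/(_ *m _) mul_mx_diag !mxE mulrC.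
by case: (b =P _) => [->|_]; rewrite ?inordK // andbF !mulr0.
Qed.

(** The eigenvalues of omega_i and omega'_i on the k-th basis vector, which has
    weight epsilon_k. *)
Definition wt (i k : nat) : K := r ^ (i == k)%:Z * s ^ (i.+1 == k)%:Z.
Definition wt' (i k : nat) : K := r ^ (i.+1 == k)%:Z * s ^ (i == k)%:Z.

(** The action on the natural module: e_i and f_i are the matrix units above and
    below the diagonal, so that root vectors are multiples of off-diagonal matrix
    units and have square 0. *)
Definition nat_rep (g : qg_gen m.+1) : M :=
  match g with
  | Ge i => munit i i.+1
  | Gf i => munit i.+1 i
  | Gw i => diag (wt i)
  | GwV i => diag (fun k => (wt i k)^-1)
  | Gv i => diag (wt' i)
  | GvV i => diag (fun k => (wt' i k)^-1)
  end.

Let root_neq0 (x : K) : x ^+ l = 1 -> x != 0.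
Proof.
move=> xl; apply/eqP => x0; have /esym/eqP := xl.
by rewrite x0 expr0n gtn_eqF ?oner_eq0 // ltnW.
Qed.
Let r0 := root_neq0 rl.
Let s0 := root_neq0 sl.

Lemma wt_neq0 i k : wt i k != 0.
Proof. by rewrite mulf_neq0 // expfz_neq0. Qed.

Lemma wt'_neq0 i k : wt' i k != 0.
Proof. by rewrite mulf_neq0 // expfz_neq0. Qed.

Lemma wt_pairing i j : wt i j = r ^ pairing i j * s ^ pairing i.+1 j * wt i j.+1.
Proof. by rewrite /wt mulrACA -!expfzDr // !subrK. Qed.

Lemma wt'_pairing i j : wt' i j = r ^ pairing i.+1 j * s ^ pairing i j * wt' i j.+1.
Proof. by rewrite /wt' mulrACA -!expfzDr // !subrK. Qed.

Lemma wt_pairingN i j : wt i j.+1 = r ^ (- pairing i j) * s ^ (- pairing i.+1 j) * wt i j.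
Proof. by rewrite /wt mulrACA -!expfzDr // !opprB !subrK. Qed.

Lemma wt'_pairingN i j : wt' i j.+1 = r ^ (- pairing i.+1 j) * s ^ (- pairing i j) * wt' i j.
Proof. by rewrite /wt' mulrACA -!expfzDr // !opprB !subrK. Qed.

Lemma wt_sub : forall i : 'I_m, (r - s)^-1 *: (diag (wt i) - diag (wt' i)) = munit i i - munit i.+1 i.+1.
Proof.
move=> i; have im := ltn_ord i; have im' := ltnW im.
apply/matrixP => a b; rewrite !mxE -!val_eqE /= !inordK //.
rewrite /wt /wt'; have [ab|ab] := eqVneq (a : nat) b; last first.
  have nab k : ((a : nat) == k) && ((b : nat) == k) = false.
    by apply: contra_neqF ab => /andP[/eqP-> /eqP->].
  by rewrite !mulr0n subrr mulr0 !nab subrr.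
rewrite -ab !mulr1n !andbb ![(a : nat) == _]eq_sym.
have [ia|ia] := eqVneq (i : nat) a.
  by rewrite -ia (gtn_eqF (ltnSn i)) /= !expr0z !expr1z mulr1 mul1r mulVf ?subr0 // subr_eq0.
have [_|_] := eqVneq i.+1 (a : nat) => /=; last by rewrite !expr0z !subrr mulr0.
by rewrite !expr0z !expr1z mul1r mulr1 sub0r -(opprB r s) mulrN mulVf // subr_eq0.
Qed.

Lemma nat_relator a : U_relator r s a -> free_eval nat_rep a = 0.
Proof.
pose F := free_alg K (qg_gen m.+1).
pose h : F -> M := free_eval nat_rep; rewrite -[free_eval _ a]/(h a).
have hB x' y : h (x' - y) = h x' - h y by rewrite /h rmorphB.
have hD x' y : h (x' + y) = h x' + h y by rewrite /h rmorphD.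
have hM x' y : h (x' * y) = h x' * h y by rewrite /h rmorphM.
have hZ k x' : h (k *: x') = k *: h x' by rewrite /h linearZ.
have h1 : h 1 = 1 by rewrite /h rmorph1.
have hg x' : h (free_gen K x') = nat_rep x' by rewrite /h free_evalE.
move: h hB hD hM hZ h1 hg => h hB hD hM hZ h1 hg.
have ltm (i : 'I_m.+1.-1) : (i < m)%N := ltn_ord i.
have lem (i : 'I_m.+1.-1) : (i <= m)%N := ltnW (ltm i).
have nS i : (i.+1 == i) = false by rewrite gtn_eqF.
have nS' i : (i == i.+1) = false by rewrite ltn_eqF.
have ee (i : 'I_m.+1.-1) : munit i i.+1 * munit i i.+1 = 0.
  by rewrite munitM ?ltm ?lem // nS.
have ff (i : 'I_m.+1.-1) : munit i.+1 i * munit i.+1 i = 0.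
  by rewrite munitM ?ltm ?lem // nS'.
have ee' (j i : 'I_m.+1.-1) : j = i.+1 :> nat -> munit j j.+1 * munit i i.+1 = 0.
  by move=> ji; rewrite munitM ?ltm ?lem // gtn_eqF // ji.
have ff' (i j : 'I_m.+1.-1) : j = i.+1 :> nat -> munit i.+1 i * munit j.+1 j = 0.
  by move=> ji; rewrite munitM ?ltm ?lem // ltn_eqF // ji.
case=> {a} [g g' tg tg'|i|i|i j|i j|i j|i j|i j|i j ij|i j ij|i j ij|i j ij|i j ij|i j ij].
- rewrite hB !hM !hg; case: g tg => // i _; case: g' tg' => // j _ /=;
  rewrite !diagM; apply/eqP; rewrite subr_eq0; apply/eqP/eq_diag => k _; exact: mulrC.
- rewrite hB hM !hg h1 /= diagM -diag1; apply/eqP; rewrite subr_eq0; apply/eqP/eq_diag => k _.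
  by rewrite divff ?wt_neq0.
- rewrite hB hM !hg h1 /= diagM -diag1; apply/eqP; rewrite subr_eq0; apply/eqP/eq_diag => k _.
  by rewrite divff ?wt'_neq0.
- by rewrite hB hZ !hM !hg /= diag_munit // munit_diag // scalerA -wt_pairing subrr.
- by rewrite hB hZ !hM !hg /= diag_munit // munit_diag // scalerA -wt_pairingN subrr.
- by rewrite hB hZ !hM !hg /= diag_munit // munit_diag // scalerA -wt'_pairing subrr.
- by rewrite hB hZ !hM !hg /= diag_munit // munit_diag // scalerA -wt'_pairingN subrr.
- rewrite !hB hZ !hB !hM !hg /= !munitM // eqSS.
  have [->|ij] := eqVneq i j; first by rewrite !eqxx mul1r wt_sub subrr.
  have [ij'|_] := eqVneq (i : nat) j; first by case/eqP: ij; apply: val_inj.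
  have [ji|_] := eqVneq (j : nat) i; first by case/eqP: ij; apply: val_inj.
  by rewrite mul0r scale0r !subrr.
- rewrite hB !hM !hg /= !munitM //; case/orP: ij => ij.
    by rewrite (ltn_eqF ij) gtn_eqF ?subrr // ltnW // ltnW.
  by rewrite (ltn_eqF ij) gtn_eqF ?subrr // ltnW // ltnW.
- rewrite hB !hM !hg /= !munitM //; case/orP: ij => ij.
    by rewrite (gtn_eqF ij) ltn_eqF ?subrr // ltnW // ltnW.
  by rewrite (gtn_eqF ij) ltn_eqF ?subrr // ltnW // ltnW.
- by rewrite !expr2 hD hB !hZ !hM !hg /= ee -mulrA ee' // !(mul0r, mulr0, scaler0, subrr, addr0).
- by rewrite !expr2 hD hB !hZ !hM !hg /= ee (ee' j i) // !(mul0r, mulr0, scaler0, subrr, addr0).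
- by rewrite !expr2 hD hB !hZ !hM !hg /= ff (ff' i j) // !(mul0r, mulr0, scaler0, subrr, addr0).
- by rewrite !expr2 hD hB !hZ !hM !hg /= ff -mulrA ff' // !(mul0r, mulr0, scaler0, subrr, addr0).
Qed.

Lemma ext_ord (x : 'I_m -> U m.+1 r s) i (im : (i < m)%N) : 
  ext (n := m.+1) x i = x (Ordinal im).
Proof. by rewrite /ext insubT. Qed.

(** Of the two products in the recursive definition of a root vector only
    one is nonzero, so a root vector is a multiple of a matrix unit. *)
Lemma rootE_munit (phi : {lrmorphism U m.+1 r s -> M}) i j :
    (forall x, phi (Ugen r s x) = nat_rep x) -> (i < m)%N -> (j <= i)%N ->
  exists c, phi (Defs.rootE m.+1 r s i j) = c *: munit j i.+1.
Proof.
move=> phiE; rewrite /Defs.rootE.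
have e0 k (km : (k < m)%N) : phi (ext (n := m.+1) (Ugen r s \o @Ge m.+1) k) = munit k k.+1.
  by rewrite (ext_ord _ km) /= phiE.
elim: i => [|i IH] im ji.
  by exists 1; rewrite scale1r /=; move: ji; rewrite leqn0 => /eqP->; apply: e0.
have im' := ltnW im; rewrite /=; case: eqP => [ij|ij].
  by exists 1; rewrite scale1r -ij e0.
have {}ji : (j <= i)%N by rewrite -ltnS ltn_neqAle ji andbT; apply/eqP => ji'; apply: ij.
have hZM k a b : phi (k *: (a * b)) = k *: (phi a * phi b) by rewrite linearZ /= rmorphM.
have [c IHc] := IH im' ji; exists (- (r^-1 * c)).
have jm : (j <= m)%N := leq_trans ji (ltnW im').
rewrite rmorphB /= hZM rmorphM /= IHc e0 // -scalerAr -scalerAl !munitM //.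
by rewrite gtn_eqF ?ltnS ?(leq_trans ji) // eqxx scaler0 sub0r scalerA scaleNr.
Qed.

Lemma rootF_munit (phi : {lrmorphism U m.+1 r s -> M}) i j :
    (forall x, phi (Ugen r s x) = nat_rep x) -> (i < m)%N -> (j <= i)%N ->
  exists c, phi (Defs.rootF m.+1 r s i j) = c *: munit i.+1 j.
Proof.
move=> phiE; rewrite /Defs.rootF.
have f0 k (km : (k < m)%N) : phi (ext (n := m.+1) (Ugen r s \o @Gf m.+1) k) = munit k.+1 k.
  by rewrite (ext_ord _ km) /= phiE.
elim: i => [|i IH] im ji.
  by exists 1; rewrite scale1r /=; move: ji; rewrite leqn0 => /eqP->; apply: f0.
have im' := ltnW im; rewrite /=; case: eqP => [ij|ij].
  by exists 1; rewrite scale1r -ij f0.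
have {}ji : (j <= i)%N by rewrite -ltnS ltn_neqAle ji andbT; apply/eqP => ji'; apply: ij.
have hZM k a b : phi (k *: (a * b)) = k *: (phi a * phi b) by rewrite linearZ /= rmorphM.
have [c IHc] := IH im' ji; exists c.
have jm : (j <= m)%N := leq_trans ji (ltnW im').
rewrite rmorphB /= hZM rmorphM /= IHc f0 // -scalerAr -scalerAl !munitM //.
by rewrite eqxx ltn_eqF ?ltnS ?(leq_trans ji) // !scaler0 subr0.
Qed.

Lemma nat_u_relator (phi : {lrmorphism U m.+1 r s -> M}) :
  (forall x, phi (Ugen r s x) = nat_rep x) -> forall a, u_relator l a -> phi a = 0.
Proof.
move=> phiE.
have sq0 c i j : (i <= m)%N -> (j <= m)%N -> i != j -> (c *: munit i j) ^+ l = 0.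
  move=> im jm ij; case: (l) l_gt1 => [|[|k]] // _.
  by rewrite exprS exprS mulrA -scalerAl -scalerAr munitM // eq_sym (negPf ij) !scaler0 mul0r.
move=> _ [i j ji|i j ji|i|i].
- have im := ltn_ord i; have [c cE] := rootE_munit phiE im ji.
  rewrite rmorphXn /= cE sq0 //; first exact: leq_trans ji (ltnW im).
  by rewrite ltn_eqF // ltnS.
- have im := ltn_ord i; have [c cE] := rootF_munit phiE im ji.
  rewrite rmorphXn /= cE sq0 //; first exact: leq_trans ji (ltnW im).
  by rewrite gtn_eqF // ltnS.
- rewrite rmorphB rmorph1 rmorphXn /= phiE /= diagX -diag1; apply/eqP; rewrite subr_eq0.
  apply/eqP/eq_diag => k _; rewrite exprMn.
  by case: eqP; case: eqP; rewrite ?expr1z ?expr0z ?rl ?sl ?expr1n ?mulr1.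
- rewrite rmorphB rmorph1 rmorphXn /= phiE /= diagX -diag1; apply/eqP; rewrite subr_eq0.
  apply/eqP/eq_diag => k _; rewrite exprMn.
  by case: eqP; case: eqP; rewrite ?expr1z ?expr0z ?rl ?sl ?expr1n ?mulr1.
Qed.

Lemma u_e_neq0_succ (l_gt0 : (0 < l)%N) (i : 'I_m.+1.-1) :
  @ugen K m.+1 r s l l_gt0 (Ge i) != 0.
Proof.
have [phi phiE] := U_lift nat_relator.
have [psi psiE] := u_lift l_gt0 (nat_u_relator phiE).
apply/eqP => e0; have := psiE (Ge i); rewrite e0 raddf0 phiE /= => /esym/matrixP.
move/(_ (inord i) (inord i.+1)); rewrite !mxE !eqxx /= => /eqP.
by rewrite oner_eq0.
Qed.

End NaturalRepresentation.

Lemma u_e_neq0 (K : fieldType) (n : nat) (r s : K) (l : nat) (l_gt0 : (0 < l)%N)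
    (i : 'I_n.-1) :
  (1 < l)%N -> r ^+ l = 1 -> s ^+ l = 1 -> r != s -> ugen r s l_gt0 (Ge i) != 0.
Proof.
case: n i => [|m] i l_gt1 rl sl rs; first by case: i.
exact: u_e_neq0_succ.
Qed.

(** * The theorem *)

Lemma mul_expr_closed (R : pzRingType) (Q : R -> Prop) (g : R) k x :
  (forall a, Q a -> Q (g * a)) -> Q x -> Q (g ^+ k * x).
Proof.
by move=> Qg Qx; elim: k => [|k IH]; rewrite ?expr0 ?mul1r // exprS -mulrA; apply: Qg.
Qed.

(** The inverses of toral generators are their (l - 1)-st powers, so the generators
    e, f, omega and omega' suffice for induction. *)
Lemma u_restricted_qg (K : fieldType) (n : nat) (r s : K) (l : nat) (l_gt0 : (0 < l)%N)
    (H : hopf (u n r s l_gt0)) :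
    (1 < l)%N -> r ^+ l = 1 -> s ^+ l = 1 -> r != s -> standard_hopf H ->
  restricted_qg l r s H (ugen r s l_gt0 \o @Ge n) (ugen r s l_gt0 \o @Gf n)
    (ugen r s l_gt0 \o @Gw n) (ugen r s l_gt0 \o @Gv n).
Proof.
move=> l_gt1 rl sl rs [Dw Dv De Df _].
pose pi : {lrmorphism free_alg K (qg_gen n) -> u n r s l_gt0} := @upi K n r s l l_gt0.
have pir a : U_relator r s a -> pi a = 0 by apply: upi_relator.
have pig g : pi (free_gen K g) = ugen r s l_gt0 g by apply: upi_gen.
move: pi pir pig => pi pir pig.
have piB a b : pi (a - b) = 0 -> pi a = pi b.
  by rewrite rmorphB => /eqP; rewrite subr_eq0 => /eqP.
have piM a b : pi (a * b) = pi a * pi b by rewrite rmorphM.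
have piZ k a : pi (k *: a) = k *: pi a by rewrite linearZ.
have pi1 : pi 1 = 1 by rewrite rmorph1.
have tor_order (g : 'I_n.-1 -> qg_gen n) i : (forall i, u_relator l (Ugen r s (g i) ^+ l - 1)) ->
    ugen r s l_gt0 (g i) ^+ l = 1.
  move=> /(_ i)/(qproj_eq0 (u_proper n r s l_gt0)); rewrite rmorphB rmorphXn rmorph1 => /eqP.
  by rewrite subr_eq0 => /eqP.
have wl i := tor_order (@Gw n) i (torw r s l).
have vl i := tor_order (@Gv n) i (torv r s l).
have inv_pow (g g' : qg_gen n) : U_relator r s (free_gen K g * free_gen K g' - 1) ->
    ugen r s l_gt0 g ^+ l = 1 -> ugen r s l_gt0 g' = ugen r s l_gt0 g ^+ l.-1.
  move=> /pir/piB; rewrite piM !pig pi1 => gg' gl.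
  rewrite -[RHS]mulr1 -gg' mulrA -exprSr prednK // gl mul1r //.
split=> /=.
- move=> Q Q1 QL QM; apply: u_ind => // g a Qa.
  have Qe i b : Q b -> Q (ugen r s l_gt0 (Ge i) * b) by move=> /(QM i)[].
  have Qf i b : Q b -> Q (ugen r s l_gt0 (Gf i) * b) by move=> /(QM i)[].
  have Qw i b : Q b -> Q (ugen r s l_gt0 (Gw i) * b) by move=> /(QM i)[].
  have Qv i b : Q b -> Q (ugen r s l_gt0 (Gv i) * b) by move=> /(QM i)[].
  case: g => i; [exact: Qe | exact: Qf | exact: Qw | | exact: Qv | ].
  + rewrite (inv_pow _ _ (w_inv r s i) (wl i)).
    exact: (mul_expr_closed _ (Qw i) Qa).
  + rewrite (inv_pow _ _ (v_inv r s i) (vl i)).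
    exact: (mul_expr_closed _ (Qv i) Qa).
- move=> i j; split; rewrite -!pig -!piM; apply: piB; apply: pir; exact: tor_comm.
- by move=> i; rewrite wl vl.
- by move=> i j; rewrite -!pig -!piM -piZ; apply: piB; apply: pir; apply: w_e.
- by move=> i j; rewrite -!pig -!piM -piZ; apply: piB; apply: pir; apply: w_f.
- by move=> i j; rewrite -!pig -!piM -piZ; apply: piB; apply: pir; apply: v_e.
- by move=> i j; rewrite -!pig -!piM -piZ; apply: piB; apply: pir; apply: v_f.
- move=> i; rewrite -!pig -!piM -!rmorphB -piZ; apply: piB; apply: pir.
  by have := e_f r s i i; rewrite eqxx mul1r.
- by move=> i; apply: u_e_neq0.
- by move=> x xl; apply: u_char.
- by move=> i; rewrite Dw Dv De Df.
Qed.

Lemma gcdz1_unit_Zp (l : nat) (k : int) : (1 < l)%N -> gcdz k l%:Z = 1 ->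
  (k%:~R : 'Z_l) \is a GRing.unit.
Proof.
move=> l_gt1 kl; have [a [b ab]] := Bezoutz k l%:Z.
apply/unitrPr; exists a%:~R; rewrite -intrM mulrC.
have -> : a * k = 1 - b * l%:Z by rewrite -kl -ab addrK.
by rewrite intrB intrM -[l%:Z%:~R]/(l%:R) pchar_Zp // mulr0 subr0.
Qed.

Theorem theorem2p12 (K : closedFieldType) (charK : [pchar K] =i pred0)
    (n : nat) (n_ge2 : (2 <= n)%N)
    (r s theta : K) (a b l y z : nat)
    (r_order : a.-primitive_root r) (s_order : b.-primitive_root s)
    (rs : r <> s) (lE : l = lcmn a b)
    (theta_order : l.-primitive_root theta)
    (ry : r = theta ^+ y) (sz : s = theta ^+ z)
    (H : hopf (u n r s (prim_order_gt0 theta_order)))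
    (H_standard : standard_hopf H)
    (coprime_sum :
       gcdz (\sum_(i < n) (-1) ^+ i * y%:Z ^+ (n.-1 - i) * z%:Z ^+ i) l%:Z = 1)
    (coprime_diff : gcdz (y%:Z - z%:Z) l%:Z = 1) :
  bijective (@Phi K _ H) <-> gcdz ((y%:Z - z%:Z) * n%:Z) l%:Z = 1.
Proof.
subst r s.
have rl : (theta ^+ y) ^+ l = 1 by rewrite exprAC (prim_expr_order theta_order) expr1n.
have sl : (theta ^+ z) ^+ l = 1 by rewrite exprAC (prim_expr_order theta_order) expr1n.
have l_gt1 : (1 < l)%N.
  have := prim_order_gt0 theta_order; rewrite leq_eqVlt => /orP[/eqP l1|//].
  by case: rs; rewrite -[LHS]expr1 -[RHS]expr1 [in LHS]l1 [in RHS]l1 rl sl.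
have rsN : theta ^+ y != theta ^+ z by apply/eqP.
have qg := u_restricted_qg l_gt1 rl sl rsN H_standard.
split=> [Pbij|/(gcdz1_unit_Zp l_gt1)]; last first.
  rewrite intrM intrB unitrM => /andP[yzu nu].
  exact: (Phi_bijective l_gt1 theta_order rsN qg yzu nu).
(* as y - z is prime to l, failure means that n and l share a prime *)
apply/eqP; rewrite -/(coprimez _ _) coprimezMl /coprimez coprime_diff eqxx /=.
apply: contrapT => /negP nl.
have g1 : (1 < gcdn n l)%N.
  by rewrite ltn_neqAle gcdn_gt0 (ltnW n_ge2) andbT eq_sym; move: nl.
have [p p_pr] := pdivP g1; rewrite dvdn_gcd => /andP[pn pl].
apply: (Phi_not_injective l_gt1 theta_order rsN qg p_pr pn pl n_ge2 _ (bij_inj Pbij)).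
have := gcdz1_unit_Zp l_gt1 coprime_sum; rewrite rmorph_sum /=.
congr (_ \is a _); apply: eq_bigr => i _.
by rewrite !rmorphM /= !rmorphXn /= rmorphN rmorph1.
Qed.
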